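(* For fixed real numbers $u$ and $v$ such that $0\le u<v<1$, the functions $t\mapsto S_2(u,v;t)$ and $t\mapsto S_3(u,v;t)$ are strictly convex on $0<t<\infty$. In other words, $\frac{\partial S_2}{\partial t}(u,v;t)$ and $\frac{\partial S_3}{\partial t}(u,v;t)$ are negative and strictly increasing (as functions of $t$) on $0<t<\infty$.
   Context: For $\mathrm{Im}\,\tau>0$ put $q=e^{\pi i\tau}$ and define the Jacobi theta functions $$\theta_2(z|\tau)=2\sum_{n=0}^{\infty}q^{(n+\frac12)^2}\cos\big((2n+1)\pi z\big),\qquad \theta_3(z|\tau)=1+2\sum_{n=1}^{\infty}q^{n^2}\cos(2n\pi z),$$ where $q^{(n+1/2)^2}$ means $e^{\pi i\tau(n+1/2)^2}$. For $j=2,3$ and $t>0$ define $$S_j(u,v;t)=\frac{\theta_j(u/2\,|\,i\pi t)}{\theta_j(v/2\,|\,i\pi t)},$$ that is, $\tau=i\pi t$, so that $q=e^{-\pi^2 t}$. *)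

(* Defs.v *)
From Stdlib Require Import Reals.
From Coquelicot Require Import Coquelicot.
Open Scope R_scope.

(** The theta functions are used only for real [z] and on the positive
    imaginary axis [tau = i y], [y > 0], where the nome [q = exp (pi i tau)]
    is the real number [exp (- pi y)] in (0, 1) and the series are real. *)
Definition nome (y : R) : R := exp (- (PI * y)).

(** [theta2 z y] is theta_2(z | i y).  [Rpower q a] is [exp (a * ln q)], so the
    power of [q] is exp (pi i tau (n + 1/2)^2). *)
Definition theta2 (z y : R) : R :=
  2 * Series (fun n : nat =>
        Rpower (nome y) ((INR n + 1 / 2) ^ 2) * cos ((2 * INR n + 1) * PI * z)).

(** [theta3 z y] is theta_3(z | i y).  [Series] starts at 0, the sum
    over [n] at 1, hence the shift to [S n]. *)
Definition theta3 (z y : R) : R :=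
  1 + 2 * Series (fun n : nat =>
        nome y ^ (S n * S n) * cos (2 * INR (S n) * PI * z)).

(** tau = i pi t, so [y = PI * t] and [nome y = exp (- PI^2 * t)]. *)
Definition S2 (u v t : R) : R := theta2 (u / 2) (PI * t) / theta2 (v / 2) (PI * t).
Definition S3 (u v t : R) : R := theta3 (u / 2) (PI * t) / theta3 (v / 2) (PI * t).

Definition strictly_convex_on (D : R -> Prop) (f : R -> R) : Prop :=
  forall x y a : R, D x -> D y -> x <> y -> 0 < a < 1 ->
    f (a * x + (1 - a) * y) < a * f x + (1 - a) * f y.

Definition strictly_increasing_on (D : R -> Prop) (f : R -> R) : Prop :=
  forall x y : R, D x -> D y -> x < y -> f x < f y.

Definition positive_reals (t : R) : Prop := 0 < t.

(* Main.v *)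
Require Import Defs.
From Stdlib Require Import Reals Lra Lia Psatz ZArith List.
From Coquelicot Require Import Coquelicot.
Import ListNotations.
Open Scope R_scope.

(** Put s = pi^2 t, a = pi u, b = pi v, so that the nome is q = e^{-s}.  By the
    Jacobi triple product, theta_3 (respectively theta_2) is, up to factors that
    depend on the space variable alone or on t alone, the product over n >= 1 of
    1 + 2 Q cos x + Q^2 with Q = q^{2n-1} (respectively Q = q^{2n}).  Expanding
    the logarithm of each factor in a Fourier series and summing the geometric
    series over n gives ([theta_quotient])

      S_j = C exp (L(s)),   L(s) = sum_{k >= 1} w_k g(k s),
      w_k = (-1)^{k-1} (cos k a - cos k b) / k,

    with g = 1/sinh for j = 3 and g = coth - 1 for j = 2.  It is enough to prove
    L'' > 0: as L' tends to 0 at infinity, L' is then negative and increasing,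
    L decreases, and S_j' is a positive multiple of L' e^L, which increases
    ([log_convex_conclusion]).

    Now s^2 L''(s) = sum_k w_k psi(k s) with psi(y) = y^2 g''(y).  Summation by
    parts, twice, shows that sum_k w_k c_k > 0 for every strictly convex sequence
    with k c_k -> 0 ([convex_series_pos]), because the double partial sums of w
    are nonnegative: they decrease as functions of a, by a Fejer type inequality
    for sine sums ([weight_double_sum_ge0]).  For theta_2 the function psi is
    convex, and this suffices.  For theta_3 convexity just fails, in a short
    interval around y = 2.8, where the leading term of
    psi(y) = 2 sum_{n odd} (n y)^2 e^{-n y} is concave.  So part of that term is
    treated apart: the weighted sum of h(y) = (y^2 + 1/2) e^{-y} comes from a
    single factor of the product, has a closed form, and is nonnegative
    ([product_factor_ge0]), while psi - (3/2) h is convex.  The convexity claims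
    hold because, once denominators are cleared, the second derivatives are
    exponential polynomials whose Taylor coefficients at 0 are all nonnegative
    ([expoly_sum_pos], [csch_corrected_second_pos], [coth_corrected_second_pos]).

    The triple product is obtained as the limit of a finite identity between a
    product of N factors and a cosine sum whose coefficients are q-binomials
    ([finite_triple_product], [theta_partial_limit]). *)

(** * Series of real numbers *)

Lemma is_series_extR (a b : nat -> R) (l : R) :
  (forall n, a n = b n) -> is_series a l -> is_series b l.
Proof. apply is_series_ext. Qed.

Lemma is_series_zero : is_series (fun _ : nat => 0) 0.
Proof.
  apply filterlim_ext with (fun _ => 0).
  - intros n. rewrite sum_n_const. simpl. ring.
  - apply filterlim_const.
Qed.

Lemma ex_series_dominated (a b : nat -> R) :
  (forall n, Rabs (a n) <= b n) -> ex_series b -> ex_series a.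
Proof. exact (@ex_series_le R_AbsRing R_CompleteNormedModule a b). Qed.

Lemma Series_dominated (a b : nat -> R) :
  (forall n, Rabs (a n) <= b n) -> ex_series b -> Rabs (Series a) <= Series b.
Proof.
  intros H Hb. eapply Rle_trans; [apply Series_Rabs | apply Series_le; [|exact Hb]].
  - apply (ex_series_dominated _ b); [|exact Hb]. intros n. rewrite Rabs_Rabsolu. apply H.
  - intros n. split; [apply Rabs_pos | apply H].
Qed.

Lemma ex_series_scalR (c : R) (a : nat -> R) :
  ex_series a -> ex_series (fun n => c * a n).
Proof. exact (@ex_series_scal_l R_AbsRing R_NormedModule c a). Qed.

Lemma ex_series_minusR (a b : nat -> R) :
  ex_series a -> ex_series b -> ex_series (fun n => a n - b n).
Proof. exact (@ex_series_minus R_AbsRing R_NormedModule a b). Qed.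

Lemma exp_le (x y : R) : x <= y -> exp x <= exp y.
Proof.
  intros [H| ->]; [left; apply exp_increasing, H | apply Rle_refl].
Qed.

Lemma exp_pow (x : R) (n : nat) : exp x ^ n = exp (x * INR n).
Proof.
  induction n as [|n IH]. rewrite Rmult_0_r, exp_0. reflexivity.
  rewrite S_INR. simpl. rewrite IH, <- exp_plus. f_equal. ring.
Qed.

Lemma exp_opp_bounds (s : R) : 0 < s -> 0 < exp (- s) < 1.
Proof.
  intros Hs. split. apply exp_pos. rewrite <- exp_0. apply exp_increasing. lra.
Qed.

(** * Exponentially decaying kernels and their weighted sums *)

(** The constant may depend on the lower bound [y0], so kernels with a pole at 0,
    such as 1/sinh, are included; [decays 0] is boundedness away from 0. *)
Definition decays (d : R) (f : R -> R) : Prop :=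
  forall y0, 0 < y0 -> exists K, forall y, y0 <= y -> Rabs (f y) <= K * exp (- (d * y)).

Lemma pow_le_exp (m : nat) (e : R) :
  0 < e -> exists C, 0 < C /\ forall y, 0 <= y -> y ^ m <= C * exp (e * y).
Proof.
  intros He. exists (INR (fact m) / e ^ m).
  pose proof (pow_lt e m He) as Hp. pose proof (INR_fact_lt_0 m) as Hf.
  split. apply Rdiv_lt_0_compat; assumption.
  intros y Hy.
  assert (H : (e * y) ^ m / INR (fact m) <= exp (e * y)).
  { apply Rle_trans with (2 := exp_ge_taylor (e * y) m (Rmult_le_pos _ _ (Rlt_le _ _ He) Hy)).
    assert (Hg : forall k, 0 <= (e * y) ^ k / INR (fact k)).
    { intros k. apply Rmult_le_pos. apply pow_le; nra.
      left; apply Rinv_0_lt_compat, INR_fact_lt_0. }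
    destruct m as [|m]; [apply Rle_refl|]. simpl sum_f_R0.
    assert (0 <= sum_f_R0 (fun k => (e * y) ^ k / INR (fact k)) m).
    { apply cond_pos_sum. exact Hg. }
    change (fact m + m * fact m)%nat with (fact (S m)).
    change (e * y * (e * y) ^ m) with ((e * y) ^ S m). lra. }
  rewrite Rpow_mult_distr in H.
  replace (y ^ m) with (INR (fact m) / e ^ m * (e ^ m * y ^ m / INR (fact m))) by (field; lra).
  apply Rmult_le_compat_l; [|exact H]. left. apply Rdiv_lt_0_compat; assumption.
Qed.

Lemma ex_series_pow_exp (i : nat) (x : R) :
  0 < x -> ex_series (fun k => INR (S k) ^ i * exp (- (x * INR (S k)))).
Proof.
  intros Hx. destruct (pow_le_exp i (x / 2)) as [C [HC H]]. lra.
  apply (ex_series_dominated _ (fun k => C * exp (- (x / 2)) * exp (- (x / 2)) ^ k)).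
  - intros k. rewrite Rabs_pos_eq.
    2: { apply Rmult_le_pos. apply pow_le, pos_INR. left; apply exp_pos. }
    eapply Rle_trans. { apply Rmult_le_compat_r. left; apply exp_pos. apply H, pos_INR. }
    rewrite Rmult_assoc, <- exp_plus.
    replace (C * exp (- (x / 2)) * exp (- (x / 2)) ^ k)
      with (C * (exp (- (x / 2)) ^ S k)) by (simpl; ring).
    right. f_equal. rewrite exp_pow. apply f_equal. field.
  - apply (ex_series_scalR (C * exp (- (x / 2)))), ex_series_geom.
    rewrite Rabs_pos_eq by (left; apply exp_pos).
    rewrite <- exp_0. apply exp_increasing. lra.
Qed.

(** The i-th derivative in s of sum_k w_k F(k s) is [wsum w i f s] with f the
    i-th derivative of F; the sum over k >= 1 is indexed by [S k]. *)
Definition wsum (w : nat -> R) (i : nat) (f : R -> R) (s : R) : R :=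
  Series (fun k => w k * (INR (S k) ^ i * f (INR (S k) * s))).

(** The bound is uniform in s >= s0: this gives convergence, termwise
    differentiation and the decay at infinity. *)
Lemma wsum_dominated (w : nat -> R) (W d : R) (i : nat) (f : R -> R) (s0 : R) :
  (forall k, Rabs (w k) <= W) -> decays d f -> 0 < s0 ->
  exists K, 0 <= K /\ forall s k, s0 <= s ->
    Rabs (w k * (INR (S k) ^ i * f (INR (S k) * s)))
    <= K * (INR (S k) ^ i * exp (- (d * s * INR (S k)))).
Proof.
  intros Hw Hf Hs0. destruct (Hf s0 Hs0) as [K HK].
  assert (HK0 : 0 <= K).
  { specialize (HK s0 (Rle_refl _)). pose proof (Rabs_pos (f s0)).
    pose proof (exp_pos (- (d * s0))). nra. }
  assert (HW0 : 0 <= W). { pose proof (Rabs_pos (w O)). specialize (Hw O). lra. }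
  exists (W * K). split. nra.
  intros s k Hs. rewrite !Rabs_mult, Rmult_assoc.
  pose proof (pow_le _ i (pos_INR (S k))) as Hp.
  rewrite (Rabs_pos_eq (INR (S k) ^ i)) by exact Hp.
  apply Rmult_le_compat; try apply Rabs_pos.
  - apply Rmult_le_pos. exact Hp. apply Rabs_pos.
  - apply Hw.
  - rewrite <- Rmult_assoc, (Rmult_comm K), Rmult_assoc.
    apply Rmult_le_compat_l. exact Hp.
    replace (- (d * s * INR (S k))) with (- (d * (INR (S k) * s))) by ring.
    apply HK. rewrite S_INR. pose proof (pos_INR k). nra.
Qed.

Lemma ex_wsum (w : nat -> R) (W d : R) (i : nat) (f : R -> R) (s : R) :
  (forall k, Rabs (w k) <= W) -> 0 < d -> decays d f -> 0 < s ->
  ex_series (fun k => w k * (INR (S k) ^ i * f (INR (S k) * s))).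
Proof.
  intros Hw Hd Hf Hs.
  destruct (wsum_dominated w W d i f s Hw Hf Hs) as [K [HK0 HK]].
  apply (ex_series_dominated _ (fun k => K * (INR (S k) ^ i * exp (- (d * s * INR (S k)))))).
  - intros k. apply HK. lra.
  - apply (ex_series_scalR K), ex_series_pow_exp. nra.
Qed.

Lemma wsum_vanishes (w : nat -> R) (W d : R) (i : nat) (f : R -> R) :
  (forall k, Rabs (w k) <= W) -> 0 < d -> decays d f ->
  exists C, forall s, 1 <= s -> Rabs (wsum w i f s) <= C * exp (- (d / 2 * s)).
Proof.
  intros Hw Hd Hf.
  destruct (wsum_dominated w W d i f 1 Hw Hf Rlt_0_1) as [K [HK0 HK]].
  set (u k := INR (S k) ^ i * exp (- (d / 2 * INR (S k)))).
  assert (Hu : ex_series u) by (apply ex_series_pow_exp; lra).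
  exists (K * Series u). intros s Hs.
  assert (Hb : forall k, Rabs (w k * (INR (S k) ^ i * f (INR (S k) * s)))
     <= K * exp (- (d / 2 * s)) * u k).
  { intros k. eapply Rle_trans. apply HK, Hs. rewrite (Rmult_assoc K (exp (- (d / 2 * s)))).
    apply Rmult_le_compat_l. exact HK0. unfold u.
    rewrite (Rmult_comm (exp (- (d / 2 * s)))), (Rmult_assoc (INR (S k) ^ i)), <- exp_plus.
    apply Rmult_le_compat_l. apply pow_le, pos_INR.
    apply exp_le. rewrite S_INR. pose proof (pos_INR k). 
    assert (0 <= d * ((INR k + 1) * (s - 1) + INR k * s)) by
      (apply Rmult_le_pos; [lra | apply Rplus_le_le_0_compat; apply Rmult_le_pos; lra]).
    lra. }
  assert (He : ex_series (fun k => K * exp (- (d / 2 * s)) * u k)).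
  { apply (ex_series_scalR (K * exp (- (d / 2 * s)))), Hu. }
  unfold wsum. eapply Rle_trans; [apply (Series_dominated _ _ Hb He)|].
  right. rewrite Series_scal_l. ring.
Qed.

Lemma is_derive_of_quadratic_error (F : R -> R) (s l C r : R) :
  0 < r -> (forall h, Rabs h < r -> Rabs (F (s + h) - F s - h * l) <= C * h ^ 2) ->
  is_derive F s l.
Proof.
  intros Hr H. apply is_derive_Reals. intros eps Heps.
  assert (Hd : 0 < Rmin r (eps / (Rabs C + 1))).
  { apply Rmin_glb_lt. lra. apply Rdiv_lt_0_compat. lra. pose proof (Rabs_pos C). lra. }
  exists (mkposreal _ Hd). intros h Hh0 Hh. simpl in Hh.
  assert (H1 : Rabs h < r) by (eapply Rlt_le_trans; [exact Hh | apply Rmin_l]).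
  assert (H2 : Rabs h < eps / (Rabs C + 1)) by (eapply Rlt_le_trans; [exact Hh | apply Rmin_r]).
  specialize (H h H1).
  replace ((F (s + h) - F s) / h - l) with ((F (s + h) - F s - h * l) / h) by (field; exact Hh0).
  unfold Rdiv. rewrite Rabs_mult, Rabs_inv.
  pose proof (Rabs_pos_lt h Hh0) as Hp.
  apply Rmult_lt_reg_r with (Rabs h). exact Hp.
  rewrite Rmult_assoc, Rinv_l, Rmult_1_r by lra.
  eapply Rle_lt_trans. exact H.
  rewrite <- (pow2_abs h).
  pose proof (Rabs_pos C). pose proof (Rle_abs C).
  assert (Rabs h * (Rabs C + 1) < eps).
  { apply Rmult_lt_reg_r with (/ (Rabs C + 1)). apply Rinv_0_lt_compat; lra.
    rewrite Rmult_assoc, Rinv_r, Rmult_1_r by lra. exact H2. }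
  nra.
Qed.

Lemma Taylor_two (f f1 f2 : R -> R) (x h y0 B : R) :
  0 < y0 -> y0 <= x -> y0 <= x + h ->
  (forall y, 0 < y -> is_derive f y (f1 y)) ->
  (forall y, 0 < y -> is_derive f1 y (f2 y)) ->
  (forall y, y0 <= y -> Rabs (f2 y) <= B) ->
  Rabs (f (x + h) - f x - h * f1 x) <= B * h ^ 2.
Proof.
  intros Hy Hx Hxh D1 D2 HB.
  assert (HB0 : 0 <= B). { specialize (HB x Hx). pose proof (Rabs_pos (f2 x)). lra. }
  assert (C : forall g g', (forall y, 0 < y -> is_derive g y (g' y)) -> forall y, 0 < y -> continuity_pt g y).
  { intros g g' Hg y Hy'. apply derivable_continuous_pt. exists (g' y).
    apply is_derive_Reals, Hg, Hy'. }
  assert (Hmin : forall z, y0 <= z -> y0 <= Rmin x z) by (intros z Hz; apply Rmin_glb; lra).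
  destruct (MVT_gen f x (x + h) f1) as [xi [Hxi E]].
  { intros z Hz. apply D1. specialize (Hmin _ Hxh). lra. }
  { intros z Hz. apply (C f f1 D1). specialize (Hmin _ Hxh). lra. }
  assert (Hxi0 : y0 <= xi) by (specialize (Hmin _ Hxh); lra).
  destruct (MVT_gen f1 x xi f2) as [ze [Hze E2]].
  { intros z Hz. apply D2. specialize (Hmin _ Hxi0). lra. }
  { intros z Hz. apply (C f1 f2 D2). specialize (Hmin _ Hxi0). lra. }
  replace (f (x + h) - f x - h * f1 x) with (f2 ze * ((xi - x) * h)).
  2: { rewrite E. replace (f1 xi) with (f1 x + f2 ze * (xi - x)) by lra. ring. }
  rewrite Rabs_mult. apply Rmult_le_compat; try apply Rabs_pos.
  - apply HB. specialize (Hmin _ Hxi0). lra.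
  - rewrite Rabs_mult, <- pow2_abs. simpl. rewrite Rmult_1_r.
    apply Rmult_le_compat_r. apply Rabs_pos.
    revert Hxi. unfold Rmin, Rmax. destruct (Rle_dec x (x + h)); intros Hxi; unfold Rabs;
      destruct (Rcase_abs (xi - x)); destruct (Rcase_abs h); lra.
Qed.

(** Termwise differentiation.  The second derivative of each term is dominated
    near s by a summable sequence, so the Taylor remainders add up to O(h^2). *)
Lemma is_derive_wsum (w : nat -> R) (W d : R) (i : nat) (f f1 f2 : R -> R) (s : R) :
  (forall k, Rabs (w k) <= W) -> 0 < d ->
  (forall y, 0 < y -> is_derive f y (f1 y)) ->
  (forall y, 0 < y -> is_derive f1 y (f2 y)) ->
  decays d f -> decays d f1 -> decays d f2 ->
  0 < s -> is_derive (wsum w i f) s (wsum w (S i) f1 s).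
Proof.
  intros Hw Hd D1 D2 F0 F1 F2 Hs.
  destruct (F2 (s / 2)) as [K HK]. lra.
  assert (HK0 : 0 <= K).
  { specialize (HK (s / 2) (Rle_refl _)). pose proof (Rabs_pos (f2 (s / 2))).
    pose proof (exp_pos (- (d * (s / 2)))). nra. }
  assert (HW0 : 0 <= W). { pose proof (Rabs_pos (w O)). specialize (Hw O). lra. }
  set (u k := INR (S k) ^ (i + 2) * exp (- (d * (s / 2) * INR (S k)))).
  assert (Hu : ex_series u) by (apply ex_series_pow_exp; nra).
  apply (is_derive_of_quadratic_error _ _ _ (W * K * Series u) (s / 2)). lra.
  intros h Hh. apply Rabs_def2 in Hh. destruct Hh as [Hh1 Hh2].
  assert (E0 : forall t, 0 < t -> ex_series (fun k => w k * (INR (S k) ^ i * f (INR (S k) * t))))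
    by (intros t Ht; apply (ex_wsum w W d); assumption).
  assert (E1 : ex_series (fun k => w k * (INR (S k) ^ S i * f1 (INR (S k) * s))))
    by (apply (ex_wsum w W d); assumption).
  unfold wsum. rewrite <- Series_minus by (apply E0; lra).
  rewrite <- Series_scal_l.
  rewrite <- Series_minus.
  2: { apply (ex_series_minusR (fun k => w k * (INR (S k) ^ i * f (INR (S k) * (s + h)))) (fun k => w k * (INR (S k) ^ i * f (INR (S k) * s)))); apply E0; lra. }
  2: { apply (ex_series_scalR h), E1. }
  assert (Hb : forall k, Rabs (w k * (INR (S k) ^ i * f (INR (S k) * (s + h)))
     - w k * (INR (S k) ^ i * f (INR (S k) * s))
     - h * (w k * (INR (S k) ^ S i * f1 (INR (S k) * s)))) <= W * K * h ^ 2 * u k).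
  { intros k. set (N := INR (S k)).
    assert (HN : 1 <= N) by (unfold N; rewrite S_INR; pose proof (pos_INR k); lra).
    replace (_ - _ - _) with (w k * (N ^ i * (f (N * s + N * h) - f (N * s) - N * h * f1 (N * s)))).
    2: { rewrite Rmult_plus_distr_l. simpl. ring. }
    rewrite !Rabs_mult.
    pose proof (pow_le N i ltac:(lra)) as Hp.
    rewrite (Rabs_pos_eq (N ^ i)) by exact Hp.
    assert (HT : Rabs (f (N * s + N * h) - f (N * s) - N * h * f1 (N * s))
       <= K * exp (- (d * (s / 2) * N)) * (N * h) ^ 2).
    { apply (Taylor_two f f1 f2 _ _ (N * (s / 2))); try assumption; try nra.
      intros y Hy. eapply Rle_trans. apply HK. nra.
      apply Rmult_le_compat_l. exact HK0. apply exp_le. nra. }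
    unfold u. fold N.
    replace (W * K * h ^ 2 * (N ^ (i + 2) * exp (- (d * (s / 2) * N))))
      with (W * (N ^ i * (K * exp (- (d * (s / 2) * N)) * (N * h) ^ 2)))
      by (rewrite pow_add; ring).
    apply Rmult_le_compat. apply Rabs_pos. apply Rmult_le_pos. exact Hp. apply Rabs_pos.
    apply Hw. apply Rmult_le_compat_l; assumption. }
  assert (He : ex_series (fun k => W * K * h ^ 2 * u k)) by (apply (ex_series_scalR (W * K * h ^ 2)), Hu).
  eapply Rle_trans; [apply (Series_dominated _ _ Hb He)|].
  right. rewrite Series_scal_l. ring.
Qed.
Lemma decays_const_le (d : R) (f : R -> R) (y0 K : R) :
  0 < y0 -> (forall y, y0 <= y -> Rabs (f y) <= K * exp (- (d * y))) -> 0 <= K.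
Proof.
  intros Hy0 H. specialize (H y0 (Rle_refl _)). pose proof (Rabs_pos (f y0)).
  pose proof (exp_pos (- (d * y0))). nra.
Qed.

Lemma decays_weaken (d e : R) (f : R -> R) : e <= d -> decays d f -> decays e f.
Proof.
  intros He H y0 Hy0. destruct (H y0 Hy0) as [K HK]. exists K. intros y Hy.
  eapply Rle_trans. apply HK, Hy. apply Rmult_le_compat_l.
  apply (decays_const_le d f y0 K Hy0 HK). apply exp_le. nra.
Qed.

Lemma decays_plus (d : R) (f g : R -> R) :
  decays d f -> decays d g -> decays d (fun y => f y + g y).
Proof.
  intros Hf Hg y0 Hy0. destruct (Hf y0 Hy0) as [K HK]. destruct (Hg y0 Hy0) as [L HL].
  exists (K + L). intros y Hy. specialize (HK y Hy). specialize (HL y Hy).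
  pose proof (Rabs_triang (f y) (g y)). lra.
Qed.

Lemma decays_mult (d e : R) (f g : R -> R) :
  decays d f -> decays e g -> decays (d + e) (fun y => f y * g y).
Proof.
  intros Hf Hg y0 Hy0. destruct (Hf y0 Hy0) as [K HK]. destruct (Hg y0 Hy0) as [L HL].
  exists (K * L). intros y Hy. specialize (HK y Hy). specialize (HL y Hy).
  rewrite Rabs_mult.
  replace (- ((d + e) * y)) with (- (d * y) + - (e * y)) by ring. rewrite exp_plus.
  replace (K * L * _) with ((K * exp (- (d * y))) * (L * exp (- (e * y)))) by ring.
  apply Rmult_le_compat; try apply Rabs_pos; assumption.
Qed.

Lemma decays_scal (d c : R) (f : R -> R) : decays d f -> decays d (fun y => c * f y).
Proof.
  intros Hf y0 Hy0. destruct (Hf y0 Hy0) as [K HK]. exists (Rabs c * K). intros y Hy.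
  rewrite Rabs_mult, Rmult_assoc. apply Rmult_le_compat_l. apply Rabs_pos. apply HK, Hy.
Qed.

Lemma decays_pow_mult (m : nat) (d e : R) (f : R -> R) :
  e < d -> decays d f -> decays e (fun y => y ^ m * f y).
Proof.
  intros He H y0 Hy0. destruct (H y0 Hy0) as [K HK].
  destruct (pow_le_exp m (d - e)) as [C [HC HP]]. lra.
  exists (C * K). intros y Hy. rewrite Rabs_mult.
  rewrite (Rabs_pos_eq (y ^ m)) by (apply pow_le; lra).
  replace (C * K * exp (- (e * y))) with ((C * exp ((d - e) * y)) * (K * exp (- (d * y)))).
  2: { replace (- (e * y)) with ((d - e) * y + - (d * y)) by ring. rewrite exp_plus. ring. }
  apply Rmult_le_compat. apply pow_le; lra. apply Rabs_pos. apply HP; lra. apply HK, Hy.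
Qed.

Lemma decays_pow (d : R) (f : R -> R) (n : nat) :
  decays d f -> decays (INR (S n) * d) (fun y => f y ^ S n).
Proof.
  intros H. induction n as [|n IH].
  - intros y0 Hy0. destruct (H y0 Hy0) as [K HK]. exists K. intros y Hy.
    simpl. rewrite Rmult_1_r, Rmult_1_l. apply HK, Hy.
  - rewrite S_INR. replace ((INR (S n) + 1) * d) with (d + INR (S n) * d) by ring.
    apply (decays_mult d _ f (fun y => f y ^ S n) H IH).
Qed.

Lemma decays_opp (d : R) (f : R -> R) : decays d f -> decays d (fun y => - f y).
Proof.
  intros H y0 Hy0. destruct (H y0 Hy0) as [K HK]. exists K. intros y Hy.
  rewrite Rabs_Ropp. apply HK, Hy.
Qed.

(** * Sine sums with convex coefficients *)

Lemma abs_sin_mult (n : nat) (x : R) : 0 <= x <= PI -> Rabs (sin (INR n * x)) <= INR n * sin x.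
Proof.
  intros Hx. pose proof (sin_ge_0 x (proj1 Hx) (proj2 Hx)) as Hs.
  induction n as [|n IH].
  - simpl. rewrite Rmult_0_l, sin_0, Rabs_R0. lra.
  - rewrite S_INR. replace ((INR n + 1) * x) with (INR n * x + x) by ring.
    rewrite sin_plus. eapply Rle_trans; [apply Rabs_triang|].
    rewrite !Rabs_mult, (Rabs_pos_eq (sin x)) by exact Hs.
    pose proof (COS_bound x). pose proof (COS_bound (INR n * x)).
    assert (Rabs (cos x) <= 1) by (apply Rabs_le; lra).
    assert (Rabs (cos (INR n * x)) <= 1) by (apply Rabs_le; lra).
    pose proof (Rabs_pos (sin (INR n * x))). nra.
Qed.

Definition alt_sin_sum (n : nat) (x : R) : R :=
  sum_f_R0 (fun j => (-1) ^ j * sin (INR (S j) * x)) n.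

(** Multiplying by 2 (1 + cos x) telescopes the sum. *)
Lemma alt_sin_sum_closed (n : nat) (x : R) :
  2 * (1 + cos x) * alt_sin_sum n x
  = sin x + (-1) ^ n * (sin (INR (S n) * x) + sin (INR (S (S n)) * x)).
Proof.
  assert (P : forall m, sin (INR (S (S m)) * x) = 2 * cos x * sin (INR (S m) * x) - sin (INR m * x)).
  { intros m. rewrite !S_INR.
    replace ((INR m + 1 + 1) * x) with ((INR m + 1) * x + x) by ring.
    replace (INR m * x) with ((INR m + 1) * x - x) by ring.
    rewrite sin_plus, sin_minus. ring. }
  unfold alt_sin_sum. induction n as [|n IH].
  - rewrite P. simpl sum_f_R0. simpl INR. rewrite !Rmult_1_l, Rmult_0_l, sin_0. simpl. ring.
  - rewrite tech5, Rmult_plus_distr_l, IH, (P (S n)).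
    simpl pow. ring.
Qed.

Lemma alt_sin_double_sum_closed (n : nat) (x : R) :
  2 * (1 + cos x) * sum_f_R0 (fun k => alt_sin_sum k x) n
  = INR (n + 2) * sin x + (-1) ^ n * sin (INR (n + 2) * x).
Proof.
  replace (n + 2)%nat with (S (S n)) by lia.
  induction n as [|n IH].
  - simpl sum_f_R0. rewrite alt_sin_sum_closed. simpl. rewrite !Rmult_1_l. ring.
  - rewrite tech5, Rmult_plus_distr_l, IH, alt_sin_sum_closed.
    rewrite (S_INR (S (S n))). simpl pow. ring.
Qed.

(** The alternating form of the positivity of the conjugate Fejer sums: by the
    closed formula it reduces to |sin m x| <= m sin x. *)
Lemma alt_sin_double_sum_ge0 (n : nat) (x : R) :
  0 <= x < PI -> 0 <= sum_f_R0 (fun k => alt_sin_sum k x) n.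
Proof.
  intros Hx.
  assert (Hc : 0 < 2 * (1 + cos x)).
  { assert (cos PI < cos x) by (apply cos_decreasing_1; lra). rewrite cos_PI in *. lra. }
  apply Rmult_le_reg_l with (1 := Hc). rewrite Rmult_0_r, alt_sin_double_sum_closed.
  pose proof (abs_sin_mult (n + 2) x ltac:(lra)) as H.
  assert (Hp : Rabs ((-1) ^ n * sin (INR (n + 2) * x)) <= INR (n + 2) * sin x).
  { rewrite Rabs_mult, pow_1_abs, Rmult_1_l. exact H. }
  apply Rabs_le_between in Hp. lra.
Qed.

(** The coefficients of L(s); the index is shifted so that it starts at 0. *)
Definition weight (a b : R) (k : nat) : R :=
  (-1) ^ k * (cos (INR (S k) * a) - cos (INR (S k) * b)) / INR (S k).

Lemma weight_bounded (a b : R) (k : nat) : Rabs (weight a b k) <= 2.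
Proof.
  unfold weight, Rdiv. rewrite !Rabs_mult, pow_1_abs, Rmult_1_l.
  pose proof (COS_bound (INR (S k) * a)). pose proof (COS_bound (INR (S k) * b)).
  assert (Hn : 1 <= INR (S k)) by (rewrite S_INR; pose proof (pos_INR k); lra).
  rewrite (Rabs_pos_eq (/ INR (S k))) by (left; apply Rinv_0_lt_compat; lra).
  assert (H1 : Rabs (cos (INR (S k) * a) - cos (INR (S k) * b)) <= 2) by (apply Rabs_le; lra).
  assert (H2 : / INR (S k) <= 1) by (rewrite <- Rinv_1; apply Rinv_le_contravar; lra).
  assert (H3 : 0 < / INR (S k)) by (apply Rinv_0_lt_compat; lra).
  pose proof (Rabs_pos (cos (INR (S k) * a) - cos (INR (S k) * b))). nra.
Qed.

Lemma is_derive_sum_f_R0 (f f' : nat -> R -> R) (n : nat) (x : R) :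
  (forall k, is_derive (f k) x (f' k x)) ->
  is_derive (fun y => sum_f_R0 (fun k => f k y) n) x (sum_f_R0 (fun k => f' k x) n).
Proof.
  intros H. induction n as [|n IH]; simpl. apply H.
  apply (is_derive_plus (fun y => sum_f_R0 (fun k => f k y) n) (f (S n))); auto.
Qed.

(** The double partial sum is a difference of values at a and b of one function
    of x, whose derivative is minus an alternating double sine sum. *)
Lemma weight_double_sum_ge0 (a b : R) (n : nat) :
  0 <= a -> a < b -> b < PI ->
  0 <= sum_f_R0 (fun k => sum_f_R0 (weight a b) k) n.
Proof.
  intros Ha Hab Hb.
  set (C := fun y => sum_f_R0 (fun k => sum_f_R0 (fun j =>
     (-1) ^ j * cos (INR (S j) * y) / INR (S j)) k) n).
  replace (sum_f_R0 _ n) with (C a - C b).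
  2: { unfold C. rewrite <- minus_sum. apply sum_eq. intros k _.
       rewrite <- minus_sum. apply sum_eq. intros j _. unfold weight. field.
       apply not_0_INR. lia. }
  assert (D : forall x, is_derive C x (sum_f_R0 (fun k => sum_f_R0 (fun j =>
      - ((-1) ^ j * sin (INR (S j) * x))) k) n)).
  { intros x. unfold C. apply (is_derive_sum_f_R0
      (fun k y => sum_f_R0 (fun j => (-1) ^ j * cos (INR (S j) * y) / INR (S j)) k)
      (fun k x => sum_f_R0 (fun j => - ((-1) ^ j * sin (INR (S j) * x))) k)).
    intros k. apply (is_derive_sum_f_R0
      (fun j y => (-1) ^ j * cos (INR (S j) * y) / INR (S j))
      (fun j x => - ((-1) ^ j * sin (INR (S j) * x)))).
    intros j. assert (Hj : INR (S j) <> 0) by (apply not_0_INR; lia).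
    set (N := INR (S j)) in *. auto_derive. exact I. field. exact Hj. }
  destruct (MVT_gen C a b _ (fun x _ => D x)) as [c [Hc E]].
  { intros x _. apply derivable_continuous_pt. eexists. apply is_derive_Reals, D. }
  rewrite Rmin_left, Rmax_right in Hc by lra.
  assert (H := alt_sin_double_sum_ge0 n c ltac:(lra)).
  replace (sum_f_R0 _ n) with (- sum_f_R0 (fun k => alt_sin_sum k c) n) in E.
  - nra.
  - rewrite <- (Rmult_1_l (sum_f_R0 _ n)), <- Ropp_mult_distr_l_reverse.
    rewrite scal_sum. apply sum_eq. intros k _. unfold alt_sin_sum.
    rewrite Rmult_comm, scal_sum. apply sum_eq. intros j _. ring.
Qed.

Lemma double_summation_by_parts (u c : nat -> R) (n : nat) :
  sum_f_R0 (fun k => u k * c k) n =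
  sum_f_R0 (fun k => sum_f_R0 (fun j => sum_f_R0 u j) k * (c k - 2 * c (S k) + c (S (S k)))) n
  + sum_f_R0 (fun j => sum_f_R0 u j) n * (c (S n) - c (S (S n)))
  + sum_f_R0 u n * c (S n).
Proof.
  induction n as [|n IH]; [simpl; ring|]. rewrite !tech5, IH. ring.
Qed.

(** A convex sequence that tends to 0 decreases, so after two summations by parts
    every term is nonnegative except the last boundary term, which tends to 0;
    the first term is positive and bounds the sum from below. *)
Lemma convex_series_pos (u c : nat -> R) (W : R) :
  (forall k, Rabs (u k) <= W) ->
  0 < u O ->
  (forall n, 0 <= sum_f_R0 (fun k => sum_f_R0 u k) n) ->
  (forall k, 0 < c k - 2 * c (S k) + c (S (S k))) ->
  is_lim_seq (fun k => INR (S k) * c k) 0 ->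
  ex_series (fun k => u k * c k) ->
  0 < Series (fun k => u k * c k).
Proof.
  intros Hu Hu0 HU Hc Hlim Hex.
  assert (Hc0 : is_lim_seq c 0).
  { apply is_lim_seq_abs_0.
    apply (is_lim_seq_le_le (fun _ => 0) _ (fun k => Rabs (INR (S k) * c k))).
    - intros k. split. apply Rabs_pos. rewrite Rabs_mult, (Rabs_pos_eq (INR (S k))) by apply pos_INR.
      pose proof (Rabs_pos (c k)). rewrite S_INR. pose proof (pos_INR k). nra.
    - apply is_lim_seq_const.
    - apply is_lim_seq_abs in Hlim. simpl in Hlim. rewrite Rabs_R0 in Hlim. exact Hlim. }
  assert (Hdec : forall k, 0 <= c k - c (S k)).
  { apply is_lim_seq_decr_compare.
    - replace (Finite 0) with (Finite (0 - 0)) by (f_equal; ring).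
      apply is_lim_seq_minus'. exact Hc0. apply is_lim_seq_incr_1 in Hc0. exact Hc0.
    - intros n. specialize (Hc n). lra. }
  set (m := u O * (c O - 2 * c 1%nat + c 2%nat)).
  assert (Hm : 0 < m) by (apply Rmult_lt_0_compat; [exact Hu0 | apply Hc]).
  assert (Hlow : forall n, m + sum_f_R0 u n * c (S n) <= sum_n (fun k => u k * c k) n).
  { intros n. rewrite sum_n_Reals, double_summation_by_parts.
    assert (H1 : m <= sum_f_R0 (fun k => sum_f_R0 (fun j => sum_f_R0 u j) k *
        (c k - 2 * c (S k) + c (S (S k)))) n).
    { induction n as [|n IH]. unfold m; simpl; lra. rewrite tech5.
      pose proof (HU (S n)) as H.
      pose proof (Rmult_le_pos _ _ H (Rlt_le _ _ (Hc (S n)))). lra. }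
    pose proof (Rmult_le_pos _ _ (HU n) (Hdec (S n))). lra. }
  assert (Hs : forall n, Rabs (sum_f_R0 u n) <= W * INR (S n)).
  { induction n as [|n IH].
    - simpl. rewrite Rmult_1_r. apply Hu.
    - rewrite tech5. eapply Rle_trans; [apply Rabs_triang|]. rewrite (S_INR (S n)). specialize (Hu (S n)). lra. }
  assert (Hrem : is_lim_seq (fun n => sum_f_R0 u n * c (S n)) 0).
  { apply is_lim_seq_abs_0.
    apply (is_lim_seq_le_le (fun _ => 0) _ (fun k => W * Rabs (INR (S (S k)) * c (S k)))).
    - intros k. split. apply Rabs_pos. rewrite !Rabs_mult, (Rabs_pos_eq (INR _)) by apply pos_INR.
      rewrite <- Rmult_assoc. apply Rmult_le_compat_r. apply Rabs_pos.
      eapply Rle_trans. apply Hs. apply Rmult_le_compat_l.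
      pose proof (Rabs_pos (u O)). specialize (Hu O). lra. rewrite (S_INR (S k)). lra.
    - apply is_lim_seq_const.
    - apply is_lim_seq_incr_1 in Hlim. apply is_lim_seq_abs in Hlim. simpl in Hlim. rewrite Rabs_R0 in Hlim.
      replace (Finite 0) with (Rbar_mult W 0) by (simpl; f_equal; ring).
      apply is_lim_seq_scal_l. exact Hlim. }
  apply Series_correct in Hex.
  assert (Hle : Rbar_le (m + 0) (Series (fun k => u k * c k))).
  { apply (is_lim_seq_le (fun n => m + sum_f_R0 u n * c (S n)) (sum_n (fun k => u k * c k))).
    - exact Hlow.
    - apply (is_lim_seq_plus' (fun _ => m)). apply is_lim_seq_const. exact Hrem.
    - exact Hex. }
  simpl in Hle. lra.
Qed.

(** * The Fourier series of the logarithm of one product factor *)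

Definition poisson_coef (x : R) (k : nat) : R := (-1) ^ k * cos (INR (S k) * x).

Lemma quadratic_trig_pos (x Q : R) : -1 < Q < 1 -> 0 < 1 + 2 * Q * cos x + Q ^ 2.
Proof. intros HQ. pose proof (COS_bound x).
  assert (0 < (1 + Q) ^ 2) by (apply pow_lt; lra). assert (0 < (1 - Q) ^ 2) by (apply pow_lt; lra).
  assert (E : 2 * (1 + 2 * Q * cos x + Q ^ 2) = (1 + cos x) * (1 + Q) ^ 2 + (1 - cos x) * (1 - Q) ^ 2) by ring.
  destruct (Rle_lt_dec 0 (cos x)).
  - assert (0 < (1 + cos x) * (1 + Q) ^ 2) by (apply Rmult_lt_0_compat; lra).
    assert (0 <= (1 - cos x) * (1 - Q) ^ 2) by (apply Rmult_le_pos; lra). lra.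
  - assert (0 <= (1 + cos x) * (1 + Q) ^ 2) by (apply Rmult_le_pos; lra).
    assert (0 < (1 - cos x) * (1 - Q) ^ 2) by (apply Rmult_lt_0_compat; lra). lra.
Qed.

Lemma poisson_CV_radius (x Q : R) :
  -1 < Q < 1 -> Rbar_lt (Rabs Q) (CV_radius (poisson_coef x)).
Proof.
  intros HQ. apply Rbar_lt_le_trans with (Finite 1).
  - simpl. apply Rabs_def1; lra.
  - apply (proj1 (CV_radius_bounded (poisson_coef x))). exists 1. intros n.
    rewrite pow1, Rmult_1_r. unfold poisson_coef.
    rewrite Rabs_mult, pow_1_abs, Rmult_1_l. apply Rabs_le, COS_bound.
Qed.

(** The cosines satisfy a two-term recurrence, so multiplying the partial sums by
    1 + 2 Q cos x + Q^2 leaves only boundary terms. *)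
Lemma poisson_PSeries (x Q : R) :
  -1 < Q < 1 -> PSeries (poisson_coef x) Q = (cos x + Q) / (1 + 2 * Q * cos x + Q ^ 2).
Proof.
  intros HQ. pose proof (quadratic_trig_pos x Q HQ) as HD.
  set (D := 1 + 2 * Q * cos x + Q ^ 2) in *.
  apply is_series_unique.
  assert (P : forall m, cos (INR (S (S m)) * x) = 2 * cos x * cos (INR (S m) * x) - cos (INR m * x)).
  { intros m. rewrite !S_INR.
    replace ((INR m + 1 + 1) * x) with ((INR m + 1) * x + x) by ring.
    replace (INR m * x) with ((INR m + 1) * x - x) by ring.
    rewrite cos_plus, cos_minus. ring. }
  set (r n := (-1) ^ n * Q ^ (S n) * (cos (INR (S (S n)) * x) + Q * cos (INR (S n) * x))).
  assert (H : forall n, sum_n (fun k => poisson_coef x k * Q ^ k) n = (cos x + Q) / D + / D * r n).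
  { intros n. rewrite sum_n_Reals.
    replace ((cos x + Q) / D + / D * r n) with ((cos x + Q + r n) / D) by (field; lra).
    apply Rmult_eq_reg_l with D; [|lra]. replace (D * (_ / D)) with (cos x + Q + r n) by (field; lra).
    unfold r. induction n as [|n IH].
    - rewrite P. unfold poisson_coef, D. simpl. rewrite !Rmult_1_l, Rmult_0_l, cos_0. ring.
    - rewrite tech5, Rmult_plus_distr_l, IH, (P (S n)). unfold poisson_coef, D. simpl pow. ring. }
  change (is_lim_seq (sum_n (fun k => poisson_coef x k * Q ^ k)) ((cos x + Q) / D)).
  apply is_lim_seq_ext with (1 := fun n => eq_sym (H n)).
  replace (Finite ((cos x + Q) / D)) with (Finite ((cos x + Q) / D + / D * 0)) by (f_equal; ring).
  apply is_lim_seq_plus'. apply is_lim_seq_const.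
  apply (is_lim_seq_scal_l r (/ D) 0).
  apply is_lim_seq_abs_0.
  apply (is_lim_seq_le_le (fun _ => 0) _ (fun n => 2 * Rabs Q ^ S n)).
  - intros n. split. apply Rabs_pos. unfold r. rewrite !Rabs_mult, pow_1_abs, Rmult_1_l, <- RPow_abs.
    rewrite Rmult_comm. apply Rmult_le_compat_r. apply pow_le, Rabs_pos.
    pose proof (COS_bound (INR (S (S n)) * x)). pose proof (COS_bound (INR (S n) * x)).
    apply Rabs_le. nra.
  - apply is_lim_seq_const.
  - replace (Finite 0) with (Rbar_mult 2 0) by (simpl; f_equal; ring).
    apply is_lim_seq_scal_l. apply (is_lim_seq_incr_1 (fun n => Rabs Q ^ n)), is_lim_seq_geom.
    rewrite Rabs_Rabsolu. apply Rabs_def1; lra.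
Qed.

(** Integrate [poisson_PSeries] in Q from 0. *)
Lemma log_cos_series (x Q : R) :
  0 <= Q < 1 ->
  is_series (fun k => (-1) ^ k * cos (INR (S k) * x) / INR (S k) * Q ^ (S k))
    (ln (1 + 2 * Q * cos x + Q ^ 2) / 2).
Proof.
  intros HQ.
  assert (HCV : forall t, -1 < t < 1 -> Rbar_lt (Rabs t) (CV_radius (PS_Int (poisson_coef x)))).
  { intros t Ht. rewrite CV_radius_Int. apply poisson_CV_radius, Ht. }
  set (F t := PSeries (PS_Int (poisson_coef x)) t - ln (1 + 2 * t * cos x + t ^ 2) / 2).
  assert (D : forall t, -1 < t < 1 -> is_derive F t 0).
  { intros t Ht. pose proof (quadratic_trig_pos x t Ht) as HD.
    replace 0 with (PSeries (PS_derive (PS_Int (poisson_coef x))) t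
       - (cos x + t) / (1 + 2 * t * cos x + t ^ 2)).
    2: { rewrite (PSeries_ext _ (poisson_coef x)). rewrite poisson_PSeries by exact Ht. ring.
         intros n. unfold PS_derive, PS_Int. field. apply not_0_INR. lia. }
    apply (is_derive_minus (PSeries (PS_Int (poisson_coef x)))
             (fun t => ln (1 + 2 * t * cos x + t ^ 2) / 2)).
    - apply is_derive_PSeries, HCV, Ht.
    - auto_derive. simpl in HD. lra. field. lra. }
  assert (F0 : F 0 = 0).
  { unfold F. rewrite PSeries_0. simpl.
    replace (1 + 2 * 0 * cos x + 0 * (0 * 1)) with 1 by ring. rewrite ln_1. lra. }
  assert (FQ : F Q = 0).
  { destruct (Req_dec Q 0) as [-> | HQ0]. exact F0.
    rewrite <- F0. symmetry. apply (eq_is_derive F). intros t Ht. apply D; lra. lra. }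
  assert (S0 : is_series (fun k => PS_Int (poisson_coef x) k * Q ^ k) (ln (1 + 2 * Q * cos x + Q ^ 2) / 2)).
  { replace (ln _ / 2) with (PSeries (PS_Int (poisson_coef x)) Q) by (unfold F in FQ; lra).
    apply Series_correct. generalize (CV_radius_inside _ _ (HCV Q ltac:(lra))).
    intros [l Hl]. exists l. revert Hl. apply is_series_extR.
    intros n. rewrite pow_n_pow. apply Rmult_comm. }
  apply (is_series_extR (fun k => PS_Int (poisson_coef x) (S k) * Q ^ (S k))).
  { intros k. unfold PS_Int, poisson_coef. reflexivity. }
  apply (is_series_incr_1 (fun k => PS_Int (poisson_coef x) k * Q ^ k)).
  replace (plus _ _) with (ln (1 + 2 * Q * cos x + Q ^ 2) / 2). exact S0.
  unfold plus; simpl. ring.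
Qed.

(** * The contribution of one product factor *)

Lemma cosh_ge1 (x : R) : 1 <= cosh x.
Proof.
  unfold cosh. pose proof (exp_pos x). pose proof (exp_pos (- x)).
  assert (exp x * exp (- x) = 1) by (rewrite <- exp_plus, Rplus_opp_r; apply exp_0).
  pose proof (pow2_ge_0 (exp x - exp (- x))). nra.
Qed.

Lemma sinh_ge_id (x : R) : 0 <= x -> x <= sinh x.
Proof.
  intros Hx. destruct (MVT_gen sinh 0 x cosh) as [c [_ E]].
  - intros y _. apply is_derive_Reals, derivable_pt_lim_sinh.
  - intros y _. apply derivable_continuous_pt, derivable_pt_sinh.
  - rewrite sinh_0 in E. pose proof (cosh_ge1 c). nra.
Qed.

Lemma cosh_ge_quadratic (s : R) : 0 <= s -> 1 + s ^ 2 / 2 <= cosh s.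
Proof.
  intros Hs. pose proof (sinh_ge_id (s / 2) ltac:(lra)) as H.
  assert (E : cosh s = 1 + 2 * sinh (s / 2) ^ 2).
  { unfold cosh, sinh.
    replace s with (s / 2 + s / 2) at 1 2 by field.
    replace (- (s / 2 + s / 2)) with (- (s / 2) + - (s / 2)) by ring.
    rewrite !exp_plus, exp_Ropp. field. apply Rgt_not_eq, exp_pos. }
  rewrite E. nra.
Qed.

Lemma cosh_plus_cos_pos (s x : R) : 0 < s -> 0 < cosh s + cos x.
Proof.
  intros Hs. pose proof (cosh_ge_quadratic s ltac:(lra)). pose proof (COS_bound x). nra.
Qed.

Lemma decays_exp_opp : decays 1 (fun y => exp (- y)).
Proof.
  intros y0 _. exists 1. intros y _. rewrite Rabs_pos_eq by (left; apply exp_pos).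
  rewrite !Rmult_1_l. lra.
Qed.

Lemma locally_pos (s : R) (P : R -> Prop) : 0 < s -> (forall t, 0 < t -> P t) -> locally s P.
Proof.
  intros Hs H. exists (mkposreal s Hs). intros t Ht. apply H.
  unfold ball in Ht; simpl in Ht. unfold AbsRing_ball, abs, minus, plus, opp in Ht; simpl in Ht.
  apply Rabs_def2 in Ht. lra.
Qed.

(** 1 + 2 Q cos x + Q^2 = 2 Q (cosh s + cos x) for Q = e^{-s}, and the factor 2 Q
    cancels in the difference of the values at a and b. *)
Lemma wsum_exp_opp (a b s : R) :
  0 < s -> wsum (weight a b) 0 (fun y => exp (- y)) s
           = (ln (cosh s + cos a) - ln (cosh s + cos b)) / 2.
Proof.
  intros Hs.
  pose proof (exp_opp_bounds s Hs) as HQ'.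
  assert (HQ : 0 <= exp (- s) < 1) by lra. clear HQ'.
  assert (L : forall x, ln (1 + 2 * exp (- s) * cos x + exp (- s) ^ 2)
                        = ln (2 * exp (- s)) + ln (cosh s + cos x)).
  { intros x. rewrite <- ln_mult.
    - apply f_equal. unfold cosh. rewrite exp_Ropp. field. apply Rgt_not_eq, exp_pos.
    - pose proof (exp_pos (- s)). lra.
    - apply cosh_plus_cos_pos, Hs. }
  pose proof (is_series_minus _ _ _ _ (log_cos_series a _ HQ) (log_cos_series b _ HQ)) as H.
  apply is_series_unique.
  replace (_ / 2) with (plus (ln (1 + 2 * exp (- s) * cos a + exp (- s) ^ 2) / 2)
    (opp (ln (1 + 2 * exp (- s) * cos b + exp (- s) ^ 2) / 2))).
  2: { rewrite !L. unfold plus, opp; simpl. field. }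
  revert H. apply is_series_extR. intros k. unfold plus, opp; cbn [AbelianGroup.sort].
  rewrite exp_pow. unfold weight.
  replace (- s * INR (S k)) with (- (INR (S k) * s)) by ring.
  change ((-1) ^ k * cos (INR (S k) * a) / INR (S k) * exp (- (INR (S k) * s)) +
    - ((-1) ^ k * cos (INR (S k) * b) / INR (S k) * exp (- (INR (S k) * s))) =
    (-1) ^ k * (cos (INR (S k) * a) - cos (INR (S k) * b)) / INR (S k) *
      (1 * exp (- (INR (S k) * s)))).
  field. apply not_0_INR. lia.
Qed.

Lemma is_derive_exp_opp (y : R) : is_derive (fun y => exp (- y)) y (- exp (- y)).
Proof. auto_derive. exact I. ring. Qed.

Lemma is_derive_opp_exp_opp (y : R) : is_derive (fun y => - exp (- y)) y (exp (- y)).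
Proof. auto_derive. exact I. ring. Qed.

Lemma is_derive_cosh (y : R) : is_derive cosh y (sinh y).
Proof. apply is_derive_Reals, derivable_pt_lim_cosh. Qed.

Lemma is_derive_sinh (y : R) : is_derive sinh y (cosh y).
Proof. apply is_derive_Reals, derivable_pt_lim_sinh. Qed.

Lemma is_derive_eq (f : R -> R) (x l l' : R) : is_derive f x l -> l = l' -> is_derive f x l'.
Proof. intros H <-. exact H. Qed.

Lemma is_derive_log_cosh (c s : R) :
  0 < cosh s + c -> is_derive (fun s => ln (cosh s + c)) s (sinh s / (cosh s + c)).
Proof.
  intros H. eapply is_derive_eq.
  - apply (is_derive_comp ln (fun s => cosh s + c)).
    + apply is_derive_ln, H.
    + apply (is_derive_plus cosh (fun _ => c)). apply is_derive_cosh. apply is_derive_const.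
  - unfold scal, plus, zero; simpl. unfold mult; simpl. field. lra.
Qed.

Lemma is_derive_sinh_quotient (c s : R) :
  0 < cosh s + c ->
  is_derive (fun s => sinh s / (cosh s + c)) s ((1 + cosh s * c) / (cosh s + c) ^ 2).
Proof.
  intros H. eapply is_derive_eq.
  - apply (is_derive_div sinh (fun s => cosh s + c)).
    + apply is_derive_sinh.
    + apply (is_derive_plus cosh (fun _ => c)). apply is_derive_cosh. apply is_derive_const.
    + lra.
  - unfold plus, zero; simpl.
    assert (E : cosh s * cosh s = 1 + sinh s * sinh s).
    { unfold cosh, sinh. rewrite exp_Ropp. field.
      apply Rgt_not_eq, exp_pos. }
    field_simplify_eq; [|lra]. simpl. nra.
Qed.

(** Both sides of [wsum_exp_opp] are differentiated twice in s; uniqueness of the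
    derivative replaces a direct summation of the series. *)
Lemma wsum_exp_opp_second (a b s : R) :
  0 < s -> wsum (weight a b) 2 (fun y => exp (- y)) s
           = ((1 + cosh s * cos a) / (cosh s + cos a) ^ 2
              - (1 + cosh s * cos b) / (cosh s + cos b) ^ 2) / 2.
Proof.
  pose proof (weight_bounded a b) as Hw.
  pose proof decays_exp_opp as E0. pose proof (decays_opp _ _ E0) as E1.
  assert (F1 : forall s, 0 < s -> wsum (weight a b) 1 (fun y => - exp (- y)) s
     = (sinh s / (cosh s + cos a) - sinh s / (cosh s + cos b)) / 2).
  { intros t Ht.
    rewrite <- (is_derive_unique _ _ _ (is_derive_wsum (weight a b) 2 1 0 _ _ _ t Hw Rlt_0_1
       (fun y _ => is_derive_exp_opp y) (fun y _ => is_derive_opp_exp_opp y) E0 E1 E0 Ht)).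
    apply is_derive_unique.
    apply (is_derive_ext_loc (fun s => (ln (cosh s + cos a) - ln (cosh s + cos b)) / 2)).
    - apply locally_pos; [exact Ht|]. intros r Hr. symmetry. apply wsum_exp_opp, Hr.
    - apply (is_derive_ext (fun s => / 2 * (ln (cosh s + cos a) - ln (cosh s + cos b)))).
      { intros r. apply Rmult_comm. }
      eapply is_derive_eq.
      + apply is_derive_scal. apply (is_derive_minus (fun s => ln (cosh s + cos a)) (fun s => ln (cosh s + cos b)));
          apply is_derive_log_cosh, cosh_plus_cos_pos, Ht.
      + unfold minus, plus, opp; simpl. field.
        split; apply Rgt_not_eq, cosh_plus_cos_pos, Ht. }
  intros Hs.
  rewrite <- (is_derive_unique _ _ _ (is_derive_wsum (weight a b) 2 1 1 _ _ _ s Hw Rlt_0_1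
       (fun y _ => is_derive_opp_exp_opp y) (fun y _ => is_derive_exp_opp y) E1 E0 E1 Hs)).
  apply is_derive_unique.
  apply (is_derive_ext_loc (fun s => (sinh s / (cosh s + cos a) - sinh s / (cosh s + cos b)) / 2)).
  - apply locally_pos; [exact Hs|]. intros r Hr. symmetry. apply F1, Hr.
  - apply (is_derive_ext (fun s => / 2 * (sinh s / (cosh s + cos a) - sinh s / (cosh s + cos b)))).
      { intros r. apply Rmult_comm. }
      eapply is_derive_eq.
      + apply is_derive_scal. apply (is_derive_minus (fun s => sinh s / (cosh s + cos a)) (fun s => sinh s / (cosh s + cos b)));
          apply is_derive_sinh_quotient, cosh_plus_cos_pos, Hs.
      + unfold minus, plus, opp; simpl. apply Rmult_comm.
Qed.

(** The derivative in the variable q has the sign of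
    2 s^2 (C^2 - C q - 2) + (C + q)^2 with C = cosh s.  When the bracket is
    negative, s^2 <= 2 (C - 1) reduces the claim to an inequality in C and q
    alone.  The bracket is negative when cosh s - 1 is small compared with 1 + q,
    and there the logarithm compensates. *)
Lemma factor_monotone (s p q : R) :
  0 < s -> -1 <= q -> q <= p -> p <= 1 ->
  s ^ 2 * ((1 + cosh s * q) / (cosh s + q) ^ 2) + ln (cosh s + q) / 2
  <= s ^ 2 * ((1 + cosh s * p) / (cosh s + p) ^ 2) + ln (cosh s + p) / 2.
Proof.
  intros Hs Hq Hqp Hp. pose proof (cosh_ge_quadratic s ltac:(lra)) as HC.
  set (C := cosh s) in *.
  assert (HC1 : 1 < C) by nra.
  set (T x := s ^ 2 * ((1 + C * x) / (C + x) ^ 2) + ln (C + x) / 2).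
  assert (D : forall x, -1 <= x -> is_derive T x
    ((2 * s ^ 2 * (C ^ 2 - C * x - 2) + (C + x) ^ 2) / (2 * (C + x) ^ 3))).
  { intros x Hx. unfold T. auto_derive.
    - repeat split; try lra. apply Rgt_not_eq. simpl.
      apply Rmult_lt_0_compat; lra.
    - field. lra. }
  destruct (MVT_gen T q p _ (fun x Hx => D x ltac:(rewrite Rmin_left in Hx by lra; lra))) as [x [Hx E]].
  { intros x Hx. rewrite Rmin_left in Hx by lra. apply derivable_continuous_pt.
    eexists. apply is_derive_Reals, D. lra. }
  rewrite Rmin_left, Rmax_right in Hx by lra.
  fold (T q) (T p).
  assert (0 <= (2 * s ^ 2 * (C ^ 2 - C * x - 2) + (C + x) ^ 2) / (2 * (C + x) ^ 3)).
  { apply Rmult_le_pos.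
    - destruct (Rle_lt_dec 0 (C ^ 2 - C * x - 2)) as [H|H].
      + apply Rplus_le_le_0_compat; [|apply pow2_ge_0].
        apply Rmult_le_pos; [|exact H]. pose proof (pow2_ge_0 s). lra.
      + assert (H1 : 4 * (C - 1) * (C ^ 2 - C * x - 2) <= 2 * s ^ 2 * (C ^ 2 - C * x - 2)) by nra.
        assert (H2 : 0 <= 4 * (C - 1) * (C ^ 2 - C * x - 2) + (C + x) ^ 2).
        { set (d := C - 1). set (m := 1 + x).
          replace C with (1 + d) by (unfold d; ring). replace x with (m - 1) by (unfold m; ring).
          assert (0 < d) by (unfold d; lra). assert (0 <= m <= 2) by (unfold m; lra).
          (* With d = cosh s - 1 and m = 1 + x, this is a sum of nonnegative terms. *)
          replace (_ + _) with ((d - m) ^ 2 + 4 * d ^ 2 + 4 * d ^ 2 * (2 - m) + 4 * d ^ 3) by ring.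
          pose proof (pow2_ge_0 (d - m)). pose proof (pow2_ge_0 d). pose proof (pow_lt d 3 ltac:(lra)). nra. }
        lra.
    - left. apply Rinv_0_lt_compat. pose proof (pow_lt (C + x) 3 ltac:(lra)). lra. }
  nra.
Qed.

(** The y^2 part of the summand is s^2 times the second derivative in s of the
    logarithm of one product factor, the 1/2 part is half that logarithm. *)
Lemma product_factor_ge0 (a b s : R) :
  0 <= a -> a < b -> b < PI -> 0 < s ->
  0 <= Series (fun k => weight a b k *
         (((INR (S k) * s) ^ 2 + 1 / 2) * exp (- (INR (S k) * s)))).
Proof.
  intros Ha Hab Hb Hs.
  pose proof (weight_bounded a b) as Hw. pose proof decays_exp_opp as E0.
  pose proof (ex_wsum (weight a b) 2 1 0 _ s Hw Rlt_0_1 E0 Hs) as X0.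
  pose proof (ex_wsum (weight a b) 2 1 2 _ s Hw Rlt_0_1 E0 Hs) as X2.
  replace (Series _) with (s ^ 2 * wsum (weight a b) 2 (fun y => exp (- y)) s
                           + / 2 * wsum (weight a b) 0 (fun y => exp (- y)) s).
  - rewrite wsum_exp_opp_second, wsum_exp_opp by exact Hs.
    assert (cos b <= cos a) by (left; apply cos_decreasing_1; lra).
    pose proof (COS_bound a). pose proof (COS_bound b).
    pose proof (factor_monotone s (cos a) (cos b) Hs ltac:(lra) ltac:(lra) ltac:(lra)). lra.
  - unfold wsum. rewrite <- !Series_scal_l.
    rewrite <- Series_plus by (apply ex_series_scalR; assumption).
    apply Series_ext. intros k. rewrite Rpow_mult_distr. simpl pow. field.
Qed.

(** * The kernels csch y and coth y - 1 *)

Definition csch (y : R) : R := / sinh y.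
Definition coth (y : R) : R := cosh y / sinh y.

Lemma sinh_pos (y : R) : 0 < y -> 0 < sinh y.
Proof. intros Hy. pose proof (sinh_ge_id y ltac:(lra)). lra. Qed.

Lemma cosh_sqr (y : R) : cosh y ^ 2 = 1 + sinh y ^ 2.
Proof. unfold cosh, sinh. rewrite exp_Ropp. field. apply Rgt_not_eq, exp_pos. Qed.

Lemma coth_sqr (y : R) : 0 < y -> coth y ^ 2 = 1 + csch y ^ 2.
Proof.
  intros Hy. pose proof (sinh_pos y Hy). unfold coth, csch.
  replace ((cosh y / sinh y) ^ 2) with (cosh y ^ 2 / sinh y ^ 2) by (field; lra).
  rewrite cosh_sqr. field. lra.
Qed.

Lemma is_derive_csch (y : R) : 0 < y -> is_derive csch y (- (coth y * csch y)).
Proof.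
  intros Hy. pose proof (sinh_pos y Hy). eapply is_derive_eq.
  - apply is_derive_inv. apply is_derive_sinh. lra.
  - unfold coth, csch. field. lra.
Qed.

Lemma is_derive_coth (y : R) : 0 < y -> is_derive coth y (- csch y ^ 2).
Proof.
  intros Hy. pose proof (sinh_pos y Hy). eapply is_derive_eq.
  - apply is_derive_div. apply is_derive_cosh. apply is_derive_sinh. lra.
  - unfold csch. pose proof (cosh_sqr y). field_simplify_eq; [|lra]. lra.
Qed.

Ltac derive_hyperbolic y Hy :=
  let H := fresh in
  auto_derive;
  [ repeat split; try exact I; 
    lazymatch goal with
    | |- context [coth] => exact (ex_intro _ _ (is_derive_coth y Hy))
    | |- context [csch] => exact (ex_intro _ _ (is_derive_csch y Hy))
    end
  | try replace (Derive (fun x : R => csch x) y) with (- (coth y * csch y))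
      by (symmetry; apply is_derive_unique, is_derive_csch, Hy);
    try replace (Derive (fun x : R => coth x) y) with (- csch y ^ 2)
      by (symmetry; apply is_derive_unique, is_derive_coth, Hy);
    pose proof (coth_sqr y Hy) as H ].

(** Successive derivatives of csch, reduced with coth^2 = 1 + csch^2. *)
Definition csch1 y := - (coth y * csch y).
Definition csch2 y := csch y + 2 * csch y ^ 3.
Definition csch3 y := - (coth y * (csch y + 6 * csch y ^ 3)).
Definition csch4 y := csch y + 20 * csch y ^ 3 + 24 * csch y ^ 5.

Lemma is_derive_csch1 y : 0 < y -> is_derive csch1 y (csch2 y).
Proof. intros Hy. unfold csch1, csch2. derive_hyperbolic y Hy.
  replace (csch y + 2 * csch y ^ 3) with (csch y * (1 + csch y ^ 2) + csch y ^ 3) by ring.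
  rewrite <- H. ring. Qed.

Lemma is_derive_csch2 y : 0 < y -> is_derive csch2 y (csch3 y).
Proof. intros Hy. unfold csch2, csch3. derive_hyperbolic y Hy. ring. Qed.

Lemma is_derive_csch3 y : 0 < y -> is_derive csch3 y (csch4 y).
Proof. intros Hy. unfold csch3, csch4. derive_hyperbolic y Hy.
  replace (csch y + 20 * csch y ^ 3 + 24 * csch y ^ 5)
   with ((1 + csch y ^ 2) * (csch y + 18 * csch y ^ 3) + csch y ^ 3 + 6 * csch y ^ 5) by ring.
  rewrite <- H. ring. Qed.

(** coth y - 1, followed by its successive derivatives. *)
Definition coth0 y := exp (- y) * csch y.
Definition coth1 y := - csch y ^ 2.
Definition coth2 y := 2 * coth y * csch y ^ 2.
Definition coth3 y := - (4 * csch y ^ 2 + 6 * csch y ^ 4).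
Definition coth4 y := coth y * (8 * csch y ^ 2 + 24 * csch y ^ 4).

Lemma is_derive_coth0 y : 0 < y -> is_derive coth0 y (coth1 y).
Proof. intros Hy. unfold coth0, coth1. derive_hyperbolic y Hy.
  assert (E : exp (- y) * (1 + coth y) = csch y).
  { unfold coth, csch. pose proof (sinh_pos y Hy).
    replace (1 + cosh y / sinh y) with (exp y / sinh y).
    2: { unfold cosh. field_simplify_eq; [|lra]. unfold sinh. field. }
    rewrite exp_Ropp. field. split. lra. apply Rgt_not_eq, exp_pos. }
  transitivity (- csch y * (exp (- y) * (1 + coth y))); [ring | rewrite E; ring]. Qed.

Lemma is_derive_coth1 y : 0 < y -> is_derive coth1 y (coth2 y).
Proof. intros Hy. unfold coth1, coth2. derive_hyperbolic y Hy. ring. Qed.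

Lemma is_derive_coth2 y : 0 < y -> is_derive coth2 y (coth3 y).
Proof. intros Hy. unfold coth2, coth3. derive_hyperbolic y Hy.
  transitivity (- 2 * csch y ^ 4 - 4 * (coth y ^ 2) * csch y ^ 2); [ring | rewrite H; ring]. Qed.

Lemma is_derive_coth3 y : 0 < y -> is_derive coth3 y (coth4 y).
Proof. intros Hy. unfold coth3, coth4. derive_hyperbolic y Hy. ring. Qed.

Lemma csch_le_exp (y0 y : R) :
  0 < y0 -> y0 <= y -> csch y <= 2 / (1 - exp (- (2 * y0))) * exp (- y).
Proof.
  intros H0 Hy. pose proof (sinh_pos y ltac:(lra)) as Hs.
  assert (H1 : exp (- (2 * y0)) < 1) by (rewrite <- exp_0; apply exp_increasing; lra).
  assert (H2 : exp (- (2 * y)) <= exp (- (2 * y0))) by (apply exp_le; lra).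
  unfold csch. apply Rmult_le_reg_r with (1 := Hs). rewrite Rinv_l by lra.
  replace (_ * sinh y) with ((1 - exp (- (2 * y))) / (1 - exp (- (2 * y0)))).
  2: { unfold sinh. replace (- (2 * y)) with (- y + - y) by ring. rewrite exp_plus.
       field_simplify_eq; [|lra]. 
       assert (exp (- y) * exp y = 1) by (rewrite <- exp_plus, Rplus_opp_l; apply exp_0). nra. }
  apply Rmult_le_reg_r with (1 - exp (- (2 * y0))). lra.
  unfold Rdiv. rewrite Rmult_assoc, Rinv_l; lra.
Qed.

Lemma decays_csch : decays 1 csch.
Proof.
  intros y0 Hy0. exists (2 / (1 - exp (- (2 * y0)))). intros y Hy.
  rewrite Rabs_pos_eq, Rmult_1_l. apply csch_le_exp; eassumption.
  left. apply Rinv_0_lt_compat, sinh_pos. lra.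
Qed.

Lemma decays_coth : decays 0 coth.
Proof.
  intros y0 Hy0. exists (2 / (1 - exp (- (2 * y0)))). intros y Hy.
  pose proof (csch_le_exp y0 y Hy0 Hy) as H. pose proof (sinh_pos y ltac:(lra)) as Hs.
  pose proof (cosh_ge1 y) as Hc.
  unfold coth. rewrite Rabs_pos_eq.
  2: { left. apply Rdiv_lt_0_compat; lra. }
  rewrite Rmult_0_l, Ropp_0, exp_0, Rmult_1_r.
  assert (Hce : cosh y <= exp y).
  { unfold cosh. assert (exp (- y) <= exp y) by (apply exp_le; lra). lra. }
  assert (E : exp (- y) * exp y = 1) by (rewrite <- exp_plus, Rplus_opp_l; apply exp_0).
  apply Rle_trans with (exp y * csch y).
  - unfold csch, Rdiv. apply Rmult_le_compat_r. left; apply Rinv_0_lt_compat, Hs. exact Hce.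
  - eapply Rle_trans. apply Rmult_le_compat_l. left; apply exp_pos. exact H.
    rewrite <- Rmult_assoc, (Rmult_comm (exp y)), Rmult_assoc, (Rmult_comm (exp y)), E. lra.
Qed.

Lemma decays_csch_pow (n : nat) : decays 1 (fun y => csch y ^ S n).
Proof.
  apply (decays_weaken (INR (S n) * 1)).
  - rewrite S_INR. pose proof (pos_INR n). lra.
  - apply decays_pow, decays_csch.
Qed.

Lemma decays_coth_mult (f : R -> R) : decays 1 f -> decays 1 (fun y => coth y * f y).
Proof.
  intros H. replace 1 with (0 + 1) by ring. apply decays_mult. apply decays_coth. exact H.
Qed.

Lemma decays_csch1 : decays 1 csch1.
Proof. apply decays_opp, decays_coth_mult, decays_csch. Qed.
Lemma decays_csch2 : decays 1 csch2.
Proof. apply decays_plus. apply decays_csch. apply decays_scal, decays_csch_pow. Qed.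
Lemma decays_csch3 : decays 1 csch3.
Proof.
  apply decays_opp, decays_coth_mult, decays_plus. apply decays_csch.
  apply decays_scal, decays_csch_pow.
Qed.
Lemma decays_coth1 : decays 1 coth1.
Proof. apply (decays_opp 1 (fun y => csch y ^ 2)), decays_csch_pow. Qed.
Lemma decays_coth2 : decays 1 coth2.
Proof.
  intros y0 Hy0.
  destruct (decays_scal 1 2 _ (decays_coth_mult _ (decays_csch_pow 1)) y0 Hy0) as [K HK].
  exists K. intros y Hy. unfold coth2. rewrite Rmult_assoc. apply HK, Hy.
Qed.
Lemma decays_coth3 : decays 1 coth3.
Proof. apply decays_opp, decays_plus; apply decays_scal, decays_csch_pow. Qed.

(** * Exponential polynomials with nonnegative Taylor coefficients *)

(** (c0 + c1 z + c2 z^2) e^{rate z}. *)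
Record expoly := EP { rate : nat; qc0 : Z; qc1 : Z; qc2 : Z }.

Definition expoly_val (z : R) (t : expoly) : R :=
  (IZR (qc0 t) + IZR (qc1 t) * z + IZR (qc2 t) * z ^ 2) * exp (INR (rate t) * z).

(** (n + 2)! times the coefficient of z^{n+2} in the Taylor series: shifting by 2
    keeps the powers of the rate in the formula nonnegative. *)
Definition expoly_coef (n : nat) (t : expoly) : Z :=
  (Z.of_nat (rate t) ^ Z.of_nat n *
   (qc0 t * (Z.of_nat (rate t) * Z.of_nat (rate t)) + qc1 t * Z.of_nat (rate t) * (Z.of_nat n + 2)
    + qc2 t * (Z.of_nat n + 2) * (Z.of_nat n + 1)))%Z.

Definition Zsum (l : list Z) : Z := fold_right Z.add 0%Z l.

Definition Rsum (l : list R) : R := fold_right Rplus 0 l.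

Lemma is_series_exp (x : R) :
  is_series (fun n => x ^ n / INR (fact n)) (exp x).
Proof.
  generalize (is_exp_Reals x). unfold is_pseries. apply is_series_ext.
  intros n. rewrite pow_n_pow. reflexivity.
Qed.

Lemma exp_series_tail1 (x : R) :
  is_series (fun n => x ^ (S n) / INR (fact (S n))) (exp x - 1).
Proof.
  apply (is_series_incr_1 (fun n => x ^ n / INR (fact n))).
  replace (plus _ _) with (exp x). apply is_series_exp.
  unfold plus; simpl. lra.
Qed.

Lemma exp_series_tail2 (x : R) :
  is_series (fun n => x ^ (S (S n)) / INR (fact (S (S n)))) (exp x - 1 - x).
Proof.
  apply (is_series_incr_1 (fun n => x ^ (S n) / INR (fact (S n)))).
  replace (plus _ _) with (exp x - 1). apply exp_series_tail1.
  unfold plus; simpl. lra.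
Qed.

Lemma expoly_series (t : expoly) (z : R) :
  is_series (fun n => IZR (expoly_coef n t) * (z ^ (n + 2) / INR (fact (n + 2))))
    (expoly_val z t - (IZR (qc0 t) + (IZR (qc0 t) * INR (rate t) + IZR (qc1 t)) * z)).
Proof.
  destruct t as [j a b c]. unfold expoly_val, expoly_coef; cbn [rate qc0 qc1 qc2].
  set (J := INR j).
  pose proof (is_series_scal_l (IZR a) _ _ (exp_series_tail2 (J * z))) as H0.
  pose proof (is_series_scal_l (IZR b * z) _ _ (exp_series_tail1 (J * z))) as H1.
  pose proof (is_series_scal_l (IZR c * z ^ 2) _ _ (is_series_exp (J * z))) as H2.
  pose proof (is_series_plus _ _ _ _ (is_series_plus _ _ _ _ H0 H1) H2) as H.
  replace (_ - _) with (plus (plus (scal (IZR a) (exp (J * z) - 1 - J * z))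
    (scal (IZR b * z) (exp (J * z) - 1))) (scal (IZR c * z ^ 2) (exp (J * z)))).
  2: { unfold plus, scal; simpl; unfold mult; simpl. ring. }
  revert H. apply is_series_extR. intros n.
  unfold plus, scal; simpl plus; simpl mult; unfold mult; simpl.
  rewrite mult_IZR, !plus_IZR, !mult_IZR, !plus_IZR, <- pow_IZR, <- !INR_IZR_INZ.
  fold J. replace (n + 2)%nat with (S (S n)) by lia.
  rewrite !Rpow_mult_distr.
  change (fact n + n * fact n)%nat with (fact (S n)).
  change (fact (S n) + (fact (S n) + n * fact (S n)))%nat with (fact (S (S n))).
  replace (INR (fact (S (S n)))) with ((INR n + 2) * ((INR n + 1) * INR (fact n))).
  2: { rewrite !fact_simpl, !mult_INR, !S_INR. ring. }
  replace (INR (fact (S n))) with ((INR n + 1) * INR (fact n)).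
  2: { rewrite !fact_simpl, !mult_INR, !S_INR. ring. }
  pose proof (pos_INR n). pose proof (INR_fact_neq_0 n).
  simpl pow.
  change (@mult R_AbsRing) with Rmult. field. repeat split; lra.
Qed.

(** The first two hypotheses say that the Taylor coefficients of order 0 and 1 of
    the sum vanish, which [expoly_coef] does not see. *)
Lemma expoly_sum_pos (l : list expoly) (z : R) :
  Zsum (map qc0 l) = 0%Z ->
  Zsum (map (fun t => qc0 t * Z.of_nat (rate t) + qc1 t)%Z l) = 0%Z ->
  (forall n, (0 <= Zsum (map (expoly_coef n) l))%Z) ->
  (0 < Zsum (map (expoly_coef 0) l))%Z ->
  0 < z -> 0 < Rsum (map (expoly_val z) l).
Proof.
  intros E0 E1 Hn H0 Hz.
  assert (HS : is_series
    (fun n => IZR (Zsum (map (expoly_coef n) l)) * (z ^ (n + 2) / INR (fact (n + 2))))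
    (Rsum (map (expoly_val z) l) - (IZR (Zsum (map qc0 l)) +
       IZR (Zsum (map (fun t => qc0 t * Z.of_nat (rate t) + qc1 t)%Z l)) * z))).
  { clear E0 E1 Hn H0. induction l as [|t l IH].
    - simpl. replace (0 - (0 + 0 * z)) with 0 by ring.
      apply (is_series_extR (fun _ => 0)); [intros n; ring | apply is_series_zero].
    - pose proof (is_series_plus _ _ _ _ (expoly_series t z) IH) as H.
      cbn [map Zsum Rsum fold_right]. fold Zsum Rsum.
      fold (Zsum (map qc0 l)) (Zsum (map (fun t => qc0 t * Z.of_nat (rate t) + qc1 t)%Z l))
        (Rsum (map (expoly_val z) l)).
      rewrite !plus_IZR, mult_IZR, <- INR_IZR_INZ.
      replace (_ - _) with (plus
        (expoly_val z t - (IZR (qc0 t) + (IZR (qc0 t) * INR (rate t) + IZR (qc1 t)) * z))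
        (Rsum (map (expoly_val z) l) - (IZR (Zsum (map qc0 l)) +
       IZR (Zsum (map (fun t => qc0 t * Z.of_nat (rate t) + qc1 t)%Z l)) * z))).
      2: { unfold plus; simpl; ring. }
      revert H. apply is_series_extR. intros n.
      fold (Zsum (map (expoly_coef n) l)).
      rewrite plus_IZR. unfold plus; simpl. ring. }
  rewrite E0, E1 in HS.
  replace (_ - _) with (Rsum (map (expoly_val z) l)) in HS by ring.
  rewrite <- (is_series_unique _ _ HS).
  rewrite Series_incr_1 by (eexists; exact HS).
  assert (Hp : forall n, 0 < z ^ n / INR (fact n)).
  { intros n. apply Rdiv_lt_0_compat. apply pow_lt, Hz. apply INR_fact_lt_0. }
  apply Rplus_lt_le_0_compat.
  - apply Rmult_lt_0_compat. apply IZR_lt, H0. apply Hp.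
  - replace 0 with (Series (fun _ : nat => 0)).
    + apply Series_le.
      * intros n. split. lra. apply Rmult_le_pos. apply IZR_le, Hn. left; apply Hp.
      * apply (ex_series_incr_1 (fun n => IZR (Zsum (map (expoly_coef n) l)) * (z ^ (n + 2) / INR (fact (n + 2))))).
        eexists; exact HS.
    + apply is_series_unique, is_series_zero.
Qed.

(** With y = z / 2, the numerator of the second derivative of
    y^2 csch''(y) - (3/2) (y^2 + 1/2) e^{-y} over 8 e^y (e^{2y} - 1)^5.  With a
    smaller multiple of (y^2 + 1/2) e^{-y}, such as 1, some coefficients are
    negative. *)
Definition csch_terms : list expoly :=
  [EP 5 2 (-8) 1; EP 4 278 (-824) 319; EP 3 (-620) 240 890;
   EP 2 428 464 334; EP 1 (-118) 152 (-11); EP 0 30 (-24) 3].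
(** With y = z / 2, the second derivative of y^2 coth''(y), multiplied by
    (e^{2y} - 1)^5 / (8 e^{2y}). *)
Definition coth_terms : list expoly :=
  [EP 3 2 (-4) 1; EP 2 (-2) (-12) 11; EP 1 (-2) 12 11; EP 0 2 4 1].

(** From n = 40 on, the quadratic factor of each exponential of rate at least 2
    is nonnegative, and rate 2 absorbs rate 1; smaller n are computed. *)
Lemma csch_coef_ge0 n : (0 <= Zsum (map (expoly_coef n) csch_terms))%Z.
Proof.
  destruct (le_lt_dec 40 n) as [H|H].
  - unfold csch_terms, expoly_coef, Zsum; cbn [map fold_right rate qc0 qc1 qc2].
    set (m := Z.of_nat n). assert (Hm : (40 <= m)%Z) by lia.
    assert (P5 : (0 <= 5 ^ m)%Z) by (apply Z.pow_nonneg; lia).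
    assert (P4 : (0 <= 4 ^ m)%Z) by (apply Z.pow_nonneg; lia).
    assert (P3 : (0 <= 3 ^ m)%Z) by (apply Z.pow_nonneg; lia).
    assert (P2 : (0 < 2 ^ m)%Z) by (apply Z.pow_pos_nonneg; lia).
    change (Z.of_nat 5) with 5%Z. change (Z.of_nat 4) with 4%Z.
    change (Z.of_nat 3) with 3%Z. change (Z.of_nat 2) with 2%Z.
    change (Z.of_nat 1) with 1%Z. change (Z.of_nat 0) with 0%Z.
    rewrite Z.pow_1_l, Z.pow_0_l by lia.
    assert (Q5 : (0 <= 2 * (5*5) + -8 * 5 * (m + 2) + 1 * (m + 2) * (m + 1))%Z) by nia.
    assert (Q4 : (0 <= 278 * (4*4) + -824 * 4 * (m + 2) + 319 * (m + 2) * (m + 1))%Z) by nia.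
    assert (Q3 : (0 <= -620 * (3*3) + 240 * 3 * (m + 2) + 890 * (m + 2) * (m + 1))%Z) by nia.
    assert (Q2 : (0 <= 428 * (2*2) + 464 * 2 * (m + 2) + 334 * (m + 2) * (m + 1)
                  + (-118 * (1*1) + 152 * 1 * (m + 2) + -11 * (m + 2) * (m + 1)))%Z) by nia.
    assert (Q2' : (0 <= 428 * (2*2) + 464 * 2 * (m + 2) + 334 * (m + 2) * (m + 1))%Z) by nia.
    pose proof (Z.mul_nonneg_nonneg _ _ P5 Q5).
    pose proof (Z.mul_nonneg_nonneg _ _ P4 Q4).
    pose proof (Z.mul_nonneg_nonneg _ _ P3 Q3).
    assert (R2 : (428 * (2*2) + 464 * 2 * (m + 2) + 334 * (m + 2) * (m + 1) <=
       2 ^ m * (428 * (2*2) + 464 * 2 * (m + 2) + 334 * (m + 2) * (m + 1)))%Z).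
    { rewrite <- (Z.mul_1_l (428 * (2*2) + _ + _)) at 1.
      apply Z.mul_le_mono_nonneg_r; lia. }
    lia.
  - revert n H.
    assert (HB : forallb (fun n => (0 <=? Zsum (map (expoly_coef n) csch_terms))%Z) (seq 0 40) = true)
      by (vm_compute; reflexivity).
    intros n H. rewrite forallb_forall in HB. apply Z.leb_le, HB, in_seq. lia.
Qed.

Lemma coth_coef_ge0 n : (0 <= Zsum (map (expoly_coef n) coth_terms))%Z.
Proof.
  destruct (le_lt_dec 10 n) as [H|H].
  - unfold coth_terms, expoly_coef, Zsum; cbn [map fold_right rate qc0 qc1 qc2].
    set (m := Z.of_nat n). assert (Hm : (10 <= m)%Z) by lia.
    assert (P3 : (0 <= 3 ^ m)%Z) by (apply Z.pow_nonneg; lia).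
    assert (P2 : (0 <= 2 ^ m)%Z) by (apply Z.pow_nonneg; lia).
    change (Z.of_nat 3) with 3%Z. change (Z.of_nat 2) with 2%Z.
    change (Z.of_nat 1) with 1%Z. change (Z.of_nat 0) with 0%Z.
    rewrite Z.pow_1_l, Z.pow_0_l by lia.
    assert (Q3 : (0 <= 2 * (3*3) + -4 * 3 * (m + 2) + 1 * (m + 2) * (m + 1))%Z) by nia.
    assert (Q2 : (0 <= -2 * (2*2) + -12 * 2 * (m + 2) + 11 * (m + 2) * (m + 1))%Z) by nia.
    pose proof (Z.mul_nonneg_nonneg _ _ P3 Q3).
    pose proof (Z.mul_nonneg_nonneg _ _ P2 Q2).
    nia.
  - revert n H.
    assert (HB : forallb (fun n => (0 <=? Zsum (map (expoly_coef n) coth_terms))%Z) (seq 0 10) = true)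
      by (vm_compute; reflexivity).
    intros n H. rewrite forallb_forall in HB. apply Z.leb_le, HB, in_seq. lia.
Qed.

(** * Positivity of the second derivative *)

(** The increments r (t + s) - r t increase with t. *)
Lemma second_difference_pos (r r1 r2 : R -> R) (y s : R) :
  (forall y, 0 < y -> is_derive r y (r1 y)) ->
  (forall y, 0 < y -> is_derive r1 y (r2 y)) ->
  (forall y, 0 < y -> 0 < r2 y) ->
  0 < y -> 0 < s -> 0 < r y - 2 * r (y + s) + r (y + s + s).
Proof.
  intros D1 D2 P Hy Hs.
  assert (C : forall x, 0 < x -> continuity_pt r x).
  { intros x Hx. apply derivable_continuous_pt. eexists. apply is_derive_Reals, D1, Hx. }
  assert (Inc : forall u v, 0 < u -> u < v -> r1 u < r1 v).
  { intros u v Hu Huv. apply (incr_function r1 0 (v + 1) r2); simpl; try lra.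
    - intros x Hx _. apply D2, Hx.
    - intros x Hx _. apply P, Hx. }
  destruct (MVT_gen r y (y + s) r1) as [c [Hc E]].
  { intros x Hx. rewrite Rmin_left in Hx by lra. apply D1. lra. }
  { intros x Hx. rewrite Rmin_left in Hx by lra. apply C. lra. }
  rewrite Rmin_left, Rmax_right in Hc by lra.
  set (f t := r (t + s) - r t).
  destruct (MVT_gen f y (y + s) (fun t => r1 (t + s) - r1 t)) as [x [Hx E']].
  { intros x Hx. rewrite Rmin_left in Hx by lra. unfold f.
    apply (is_derive_minus (fun t => r (t + s)) r); [|apply D1; lra].
    eapply is_derive_eq.
    - apply (is_derive_comp r (fun t => t + s)). apply D1; lra.
      apply (is_derive_plus (fun t => t) (fun _ => s)). apply is_derive_id. apply is_derive_const.
    - unfold scal, plus, one, zero; simpl. unfold mult; simpl. ring. }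
  { intros x Hx. rewrite Rmin_left in Hx by lra. unfold f.
    apply continuity_pt_minus; [|apply C; lra].
    apply (continuity_pt_comp (fun t => t + s) r). 
    - apply continuity_pt_plus. apply derivable_continuous_pt, derivable_pt_id.
      apply continuity_pt_const. intros ? ?; reflexivity.
    - apply C. lra. }
  rewrite Rmin_left, Rmax_right in Hx by lra. unfold f in E'.
  specialize (Inc x (x + s) ltac:(lra) ltac:(lra)). nra.
Qed.

Definition corrected (B : R) (g2 : R -> R) (y : R) : R :=
  y ^ 2 * g2 y - B * ((y ^ 2 + 1 / 2) * exp (- y)).

(** The second derivative of [corrected B g2]. *)
Definition corrected_second (B : R) (g2 g3 g4 : R -> R) (y : R) : R :=
  2 * g2 y + 4 * y * g3 y + y ^ 2 * g4 y - B * ((y ^ 2 - 4 * y + 5 / 2) * exp (- y)).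

Lemma corrected_convex (B : R) (g2 g3 g4 : R -> R) (y s : R) :
  (forall y, 0 < y -> is_derive g2 y (g3 y)) ->
  (forall y, 0 < y -> is_derive g3 y (g4 y)) ->
  (forall y, 0 < y -> 0 < corrected_second B g2 g3 g4 y) ->
  0 < y -> 0 < s ->
  0 < corrected B g2 y - 2 * corrected B g2 (y + s) + corrected B g2 (y + s + s).
Proof.
  intros D2 D3 P.
  apply (second_difference_pos (corrected B g2)
    (fun y => 2 * y * g2 y + y ^ 2 * g3 y - B * ((2 * y - y ^ 2 - 1 / 2) * exp (- y)))
    (corrected_second B g2 g3 g4)); [| |exact P]; clear y s; intros y Hy; unfold corrected, corrected_second.
  - auto_derive.
    + eexists; apply D2, Hy.
    + replace (Derive (fun x : R => g2 x) y) with (g3 y) by (symmetry; apply is_derive_unique, D2, Hy).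
      field.
  - auto_derive.
    + repeat split; eexists; [apply D2, Hy | apply D3, Hy].
    + replace (Derive (fun x : R => g2 x) y) with (g3 y) by (symmetry; apply is_derive_unique, D2, Hy).
      replace (Derive (fun x : R => g3 x) y) with (g4 y) by (symmetry; apply is_derive_unique, D3, Hy).
      field.
Qed.

Lemma lim_mult_decays (d : R) (f : R -> R) (s : R) :
  0 < d -> decays d f -> 0 < s -> is_lim_seq (fun k => INR (S k) * f (INR (S k) * s)) 0.
Proof.
  intros Hd Hf Hs.
  apply is_lim_seq_ext with (fun k => 1 * (INR (S k) ^ 1 * f (INR (S k) * s))).
  { intros n. ring. }
  apply (ex_series_lim_0 (fun k => 1 * (INR (S k) ^ 1 * f (INR (S k) * s)))).
  apply (ex_wsum (fun _ => 1) 1 d 1 f s); try assumption.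
  intros _. rewrite Rabs_R1. lra.
Qed.

(** The value at k s of y^2 g''(y) is split into [corrected], a convex sequence in
    k, and B times the summand of [product_factor_ge0]. *)
Lemma wsum_second_pos (a b B s : R) (g2 g3 g4 : R -> R) :
  0 <= a -> a < b -> b < PI -> 0 <= B ->
  decays 1 g2 ->
  (forall y, 0 < y -> is_derive g2 y (g3 y)) ->
  (forall y, 0 < y -> is_derive g3 y (g4 y)) ->
  (forall y, 0 < y -> 0 < corrected_second B g2 g3 g4 y) ->
  0 < s -> 0 < wsum (weight a b) 2 g2 s.
Proof.
  intros Ha Hab Hb HB Hg D2 D3 P Hs.
  pose proof (weight_bounded a b) as Hw.
  set (h y := (y ^ 2 + 1 / 2) * exp (- y)).
  assert (Hh : decays (1 / 2) h).
  { intros y0 Hy0.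
    destruct (decays_plus (1 / 2) _ _ (decays_pow_mult 2 1 (1 / 2) _ ltac:(lra) decays_exp_opp)
      (decays_scal _ (1 / 2) _ (decays_weaken 1 (1 / 2) _ ltac:(lra) decays_exp_opp)) y0 Hy0) as [K HK].
    exists K. intros y Hy. unfold h. rewrite Rmult_plus_distr_r. apply HK, Hy. }
  assert (Hr : decays (1 / 2) (corrected B g2)).
  { apply (decays_plus (1 / 2) (fun y => y ^ 2 * g2 y) (fun y => - (B * h y))).
    - apply (decays_pow_mult 2 1). lra. exact Hg.
    - apply (decays_opp _ (fun y => B * h y)), decays_scal, Hh. }
  assert (X : forall f, decays (1 / 2) f ->
     ex_series (fun k => weight a b k * f (INR (S k) * s))).
  { intros f Hf.
    generalize (ex_wsum (weight a b) 2 (1 / 2) 0 f s Hw ltac:(lra) Hf Hs).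
    apply ex_series_ext. intros k. simpl. apply f_equal, Rmult_1_l. }
  assert (H1 : 0 < Series (fun k => weight a b k * corrected B g2 (INR (S k) * s))).
  { apply (convex_series_pos _ (fun k => corrected B g2 (INR (S k) * s)) 2 Hw).
    - unfold weight. simpl. rewrite !Rmult_1_l.
      assert (cos b < cos a) by (apply cos_decreasing_1; lra). lra.
    - intros n. apply weight_double_sum_ge0; assumption.
    - intros k. pose proof (pos_INR k).
      replace (INR (S (S k)) * s) with (INR (S k) * s + s) by (rewrite (S_INR (S k)); ring).
      replace (INR (S (S (S k))) * s) with (INR (S k) * s + s + s) by (rewrite (S_INR (S (S k))), (S_INR (S k)); ring).
      apply (corrected_convex B g2 g3 g4); try assumption.
      rewrite S_INR. apply Rmult_lt_0_compat; lra.
    - apply (lim_mult_decays (1 / 2)); try assumption. lra.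
    - apply X, Hr. }
  pose proof (product_factor_ge0 a b s Ha Hab Hb Hs) as H2. fold (h) in H2.
  assert (E : s ^ 2 * wsum (weight a b) 2 g2 s =
     Series (fun k => weight a b k * corrected B g2 (INR (S k) * s))
     + B * Series (fun k => weight a b k * h (INR (S k) * s))).
  { unfold wsum. rewrite <- !Series_scal_l.
    rewrite <- Series_plus by (first [apply X, Hr | apply ex_series_scalR, X, Hh]).
    apply Series_ext. intros k. unfold corrected, h. ring. }
  assert (0 < s ^ 2) by (apply pow_lt, Hs).
  assert (0 <= B * Series (fun k => weight a b k * h (INR (S k) * s))).
  { apply Rmult_le_pos. exact HB. exact H2. }
  apply Rmult_lt_reg_l with (s ^ 2). assumption. rewrite Rmult_0_r, E. lra.
Qed.

Lemma csch_corrected_second_pos (y : R) :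
  0 < y -> 0 < corrected_second (3 / 2) csch2 csch3 csch4 y.
Proof.
  intros Hy.
  pose proof (expoly_sum_pos csch_terms (2 * y) eq_refl eq_refl csch_coef_ge0 eq_refl ltac:(lra)) as H.
  assert (HZ : 1 < exp y) by (rewrite <- exp_0; apply exp_increasing; lra).
  assert (E : corrected_second (3 / 2) csch2 csch3 csch4 y =
    Rsum (map (expoly_val (2 * y)) csch_terms) / (8 * exp y * (exp y ^ 2 - 1) ^ 5)).
  { unfold csch_terms, Rsum, expoly_val; cbn [map fold_right rate qc0 qc1 qc2].
    assert (P : forall j, exp (INR j * (2 * y)) = exp y ^ (2 * j)).
    { intros j. rewrite exp_pow. apply f_equal. rewrite mult_INR. simpl. ring. }
    rewrite !P. unfold corrected_second, csch2, csch3, csch4, coth, csch, cosh, sinh.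
    rewrite exp_Ropp. set (Z := exp y) in *. simpl Nat.mul.
    field. repeat split; apply Rgt_not_eq; nra. }
  rewrite E. apply Rdiv_lt_0_compat. exact H.
  apply Rmult_lt_0_compat. lra. apply pow_lt. nra.
Qed.

Lemma coth_corrected_second_pos (y : R) :
  0 < y -> 0 < corrected_second 0 coth2 coth3 coth4 y.
Proof.
  intros Hy.
  pose proof (expoly_sum_pos coth_terms (2 * y) eq_refl eq_refl coth_coef_ge0 eq_refl ltac:(lra)) as H.
  assert (HZ : 1 < exp y) by (rewrite <- exp_0; apply exp_increasing; lra).
  assert (E : corrected_second 0 coth2 coth3 coth4 y =
    8 * exp y ^ 2 * Rsum (map (expoly_val (2 * y)) coth_terms) / (exp y ^ 2 - 1) ^ 5).
  { unfold coth_terms, Rsum, expoly_val; cbn [map fold_right rate qc0 qc1 qc2].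
    assert (P : forall j, exp (INR j * (2 * y)) = exp y ^ (2 * j)).
    { intros j. rewrite exp_pow. apply f_equal. rewrite mult_INR. simpl. ring. }
    rewrite !P. unfold corrected_second, coth2, coth3, coth4, coth, csch, cosh, sinh.
    rewrite exp_Ropp. set (Z := exp y) in *. simpl Nat.mul.
    field. repeat split; apply Rgt_not_eq; nra. }
  rewrite E. apply Rdiv_lt_0_compat.
  - apply Rmult_lt_0_compat; [|exact H]. nra.
  - apply pow_lt. nra.
Qed.

(** * The finite triple product *)

(** Both theta functions are treated together: d = 0 is theta_3, with frequencies
    j, and d = 1 is theta_2, with frequencies j + 1/2. *)
Definition shifted_cos (d : nat) (x : R) (j : nat) : R := cos ((INR j + INR d / 2) * x).
(** In a symmetric sum over all integers the terms j and -j-d coincide.  For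
    d = 0 the term j = 0 is its own mirror image and is counted by half. *)
Definition center_excess (d : nat) : R := match d with O => / 2 | _ => 0 end.
Definition theta_partial (d : nat) (c : nat -> R) (M : nat) (x : R) : R :=
  sum_f_R0 (fun j => c j * shifted_cos d x j) M - center_excess d * (c O * shifted_cos d x O).
(** The coefficient of index j - 1, read as that of its mirror image when
    j = 0. *)
Definition reflected_pred (d : nat) (c : nat -> R) (j : nat) : R :=
  match j with S i => c i | O => match d with O => c 1%nat | _ => c O end end.

Lemma shifted_cos_recurrence (d : nat) (x : R) (j : nat) :
  2 * cos x * shifted_cos d x (S j) = shifted_cos d x (S (S j)) + shifted_cos d x j.
Proof.
  unfold shifted_cos. rewrite !S_INR. set (y := (INR j + 1 + INR d / 2) * x).
  replace ((INR j + 1 + 1 + INR d / 2) * x) with (y + x) by (unfold y; ring).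
  replace ((INR j + INR d / 2) * x) with (y - x) by (unfold y; ring).
  rewrite cos_plus, cos_minus. ring.
Qed.

(** 2 cos x shifts the frequencies by one in both directions; the last two terms
    are what crosses the upper end of the sum. *)
Lemma theta_partial_mult (d : nat) (c : nat -> R) (al Q x : R) (M : nat) :
  (d <= 1)%nat ->
  (al + 2 * Q * cos x) * theta_partial d c M x =
  theta_partial d (fun j => al * c j + Q * (reflected_pred d c j + c (S j))) M x
  + Q * c M * shifted_cos d x (S M) - Q * c (S M) * shifted_cos d x M.
Proof.
  intros Hd. induction M as [|M IH].
  - assert (Hc : d = O \/ d = 1%nat) by lia.
    unfold theta_partial; simpl sum_f_R0. destruct Hc as [-> | ->]; unfold shifted_cos; simpl.
    + replace ((0 + 0 / 2) * x) with 0 by field. replace ((1 + 0 / 2) * x) with x by field.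
      rewrite cos_0. field.
    + replace ((1 + 1 / 2) * x) with ((0 + 1 / 2) * x + x) by field.
      set (y := (0 + 1 / 2) * x).
      assert (E : cos y = cos x * cos y + sin x * sin y).
      { rewrite <- cos_minus. apply f_equal. unfold y. field. }
      rewrite cos_plus.
      replace (Q * c O * (cos y * cos x - sin y * sin x))
        with (Q * c O * (2 * cos x * cos y - (cos x * cos y + sin x * sin y))) by ring.
      rewrite <- E. ring.
  - unfold theta_partial in *. rewrite !tech5.
    replace ((al + 2 * Q * cos x) * _) with
      ((al + 2 * Q * cos x) * (sum_f_R0 (fun j => c j * shifted_cos d x j) M - center_excess d * (c O * shifted_cos d x O))
       + al * c (S M) * shifted_cos d x (S M) + Q * c (S M) * (2 * cos x * shifted_cos d x (S M))) by ring.
    rewrite IH, shifted_cos_recurrence. cbv beta. change (reflected_pred d c (S M)) with (c M). ring.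
Qed.

Section FiniteProduct.
Variable q : R.
Hypothesis Hq : 0 < q < 1.
Variable d : nat.

Definition nome_sq : R := q ^ 2.
(** The quotient of the q^2-binomial coefficients of 2N + d over N - j and over
    N.  It vanishes for j > N through the factor i = N, and tends to 1 as N grows.
    With the central value normalized to 1, the coefficients [theta_coef] tend to
    those of the theta series. *)
Fixpoint binom_ratio (N j : nat) : R :=
  match j with
  | O => 1
  | S i => binom_ratio N i * ((1 - nome_sq ^ (N - i)) / (1 - nome_sq ^ (N + i + 1 + d)))
  end.
Definition theta_coef (N j : nat) : R := q ^ (j * j + d * j) * binom_ratio N j.
Definition factor_nome (k : nat) : R := q ^ (2 * k + 1 + d).
Fixpoint theta_product (N : nat) (x : R) : R :=
  match N with
  | O => 1
  | S n => theta_product n x * (1 + 2 * factor_nome n * cos x + factor_nome n ^ 2)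
  end.
Definition prefactor (x : R) : R := (1 - center_excess d) * shifted_cos d x O.

Lemma nome_sq_bounds : 0 < nome_sq < 1.
Proof. unfold nome_sq. nra. Qed.

Lemma nome_sq_pow_lt1 (n : nat) : nome_sq ^ S n < 1.
Proof.
  pose proof nome_sq_bounds. induction n as [|n IH]. simpl; lra.
  change (nome_sq ^ S (S n)) with (nome_sq * nome_sq ^ S n). pose proof (pow_lt nome_sq (S n) ltac:(lra)). nra.
Qed.

Lemma one_minus_pow_pos (n : nat) : (0 < n)%nat -> 0 < 1 - nome_sq ^ n.
Proof. intros Hn. destruct n as [|n]. lia. pose proof (nome_sq_pow_lt1 n). lra. Qed.

Lemma binom_ratio_S (N j : nat) :
  binom_ratio N (S j) = binom_ratio N j * ((1 - nome_sq ^ (N - j)) / (1 - nome_sq ^ (N + j + 1 + d))).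
Proof. reflexivity. Qed.

Lemma binom_ratio_vanish (N : nat) : binom_ratio N (S N) = 0.
Proof. rewrite binom_ratio_S, Nat.sub_diag. simpl. unfold Rdiv. ring. Qed.

Lemma binom_ratio_next (N j : nat) : (j <= N)%nat ->
  binom_ratio (S N) j * ((1 - nome_sq ^ (S N - j)) * (1 - nome_sq ^ (S N + j + d)))
  = (1 - nome_sq ^ S N) * (1 - nome_sq ^ (S N + d)) * binom_ratio N j.
Proof.
  induction j as [|j IH]; intros Hj.
  - change (binom_ratio (S N) 0) with 1. change (binom_ratio N 0) with 1. rewrite Nat.sub_0_r, Nat.add_0_r. ring.
  - specialize (IH ltac:(lia)). rewrite !binom_ratio_S.
    replace (S N - S j)%nat with (N - j)%nat by lia.
    replace (S N + S j + d)%nat with (S N + j + 1 + d)%nat by lia.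
    replace (S N + j + d)%nat with (N + j + 1 + d)%nat in IH by lia.
    pose proof (one_minus_pow_pos (S N + j + 1 + d) ltac:(lia)).
    pose proof (one_minus_pow_pos (N + j + 1 + d) ltac:(lia)).
    replace ((1 - nome_sq ^ S N) * (1 - nome_sq ^ (S N + d)) * _) with
      ((1 - nome_sq ^ S N) * (1 - nome_sq ^ (S N + d)) * binom_ratio N j *
       (1 - nome_sq ^ (N - j)) / (1 - nome_sq ^ (N + j + 1 + d))) by (field; lra).
    rewrite <- IH.
    field. lra.
Qed.

(** This relates the leading coefficients for N and N + 1, which fixes the
    constant in [finite_triple_product]. *)
Lemma binom_ratio_diag (N : nat) :
  binom_ratio (S N) (S N) * ((1 - nome_sq ^ (2 * N + 1 + d)) * (1 - nome_sq ^ (2 * N + 2 + d)))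
  = (1 - nome_sq ^ S N) * (1 - nome_sq ^ (S N + d)) * binom_ratio N N.
Proof.
  rewrite <- (binom_ratio_next N N (Nat.le_refl _)).
  change (binom_ratio (S N) (S N)) with
    (binom_ratio (S N) N * ((1 - nome_sq ^ (S N - N)) / (1 - nome_sq ^ (S N + N + 1 + d)))).
  replace (2 * N + 2 + d)%nat with (S N + N + 1 + d)%nat by lia.
  replace (2 * N + 1 + d)%nat with (S N + N + d)%nat by lia.
  pose proof (one_minus_pow_pos (S N + N + 1 + d) ltac:(lia)). field. lra.
Qed.

Definition binom_growth (N : nat) : R :=
  (1 - nome_sq ^ S N) * (1 - nome_sq ^ (S N + d)) /
  ((1 - nome_sq ^ (2 * N + 1 + d)) * (1 - nome_sq ^ (2 * N + 2 + d))).

(** The recurrence for the coefficients after division by q^{j^2 + d j}, with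
    A = p^{N-j} and B = p^{N+j+d}. *)
Lemma three_term_identity (p A B : R) : 1 - p * A <> 0 -> 1 - p * B <> 0 ->
  ((1 + p * A * B) + p * A * ((1 - B) / (1 - p * A)) + p * B * ((1 - A) / (1 - p * B)))
  * ((1 - p * A) * (1 - p * B)) = (1 - p * A * B) * (1 - p * (p * A * B)).
Proof. intros. field. split; assumption. Qed.

(** Multiplying by one more factor 1 + 2 Q cos x + Q^2 maps the N-th coefficients
    to a multiple of the next ones. *)
Lemma theta_coef_recurrence (N j : nat) : (d <= 1)%nat -> (j <= N)%nat ->
  theta_coef (S N) j = binom_growth N *
   ((1 + factor_nome N ^ 2) * theta_coef N j
    + factor_nome N * (reflected_pred d (theta_coef N) j + theta_coef N (S j))).
Proof.
  intros Hd Hj.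
  pose proof nome_sq_bounds as Hp.
  set (A := nome_sq ^ (N - j)). set (B := nome_sq ^ (N + j + d)). set (p := nome_sq) in *.
  assert (EA : p ^ (S N - j) = p * A).
  { unfold A. replace (S N - j)%nat with (S (N - j)) by lia. reflexivity. }
  assert (EB : p ^ (S N + j + d) = p * B) by reflexivity.
  assert (EB' : p ^ (N + j + 1 + d) = p * B).
  { rewrite <- EB. f_equal. lia. }
  assert (PA : 0 < 1 - p * A) by (rewrite <- EA; apply one_minus_pow_pos; lia).
  assert (PB : 0 < 1 - p * B) by (rewrite <- EB; apply one_minus_pow_pos; lia).
  assert (EQ : factor_nome N ^ 2 = p * A * B).
  { unfold factor_nome, A, B, p, nome_sq. rewrite <- !pow_mult, <- !pow_add. f_equal. lia. }
  assert (E1 : p ^ (2 * N + 1 + d) = p * A * B).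
  { unfold A, B. rewrite Rmult_assoc, <- pow_add. change (p * p ^ (N - j + (N + j + d))) with (p ^ S (N - j + (N + j + d))).
    f_equal. lia. }
  assert (E2 : p ^ (2 * N + 2 + d) = p * (p * A * B)).
  { rewrite <- E1. change (p * p ^ (2 * N + 1 + d)) with (p ^ S (2 * N + 1 + d)). f_equal. lia. }
  assert (PQ1 : 0 < 1 - p * A * B) by (rewrite <- E1; apply one_minus_pow_pos; lia).
  assert (PQ2 : 0 < 1 - p * (p * A * B)) by (rewrite <- E2; apply one_minus_pow_pos; lia).
  assert (Enext : factor_nome N * theta_coef N (S j) = q ^ (j * j + d * j) * binom_ratio N j * (p * B * ((1 - A) / (1 - p * B)))).
  { unfold theta_coef. rewrite binom_ratio_S. fold p. fold A. rewrite EB'.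
    replace (factor_nome N * (q ^ (S j * S j + d * S j) * (binom_ratio N j * ((1 - A) / (1 - p * B)))))
      with ((factor_nome N * q ^ (S j * S j + d * S j)) * (binom_ratio N j * ((1 - A) / (1 - p * B)))) by ring.
    replace (factor_nome N * q ^ (S j * S j + d * S j)) with (q ^ (j * j + d * j) * (p * B)).
    ring.
    rewrite <- EB. unfold factor_nome, p, nome_sq. rewrite <- pow_mult, <- !pow_add. f_equal. lia. }
  assert (Eprev : factor_nome N * reflected_pred d (theta_coef N) j = q ^ (j * j + d * j) * binom_ratio N j * (p * A * ((1 - B) / (1 - p * A)))).
  { destruct j as [|j].
    - assert (Hc : d = O \/ d = 1%nat) by lia. destruct Hc as [Hc|Hc].
      + unfold reflected_pred. rewrite Hc. rewrite Hc in Enext. rewrite Enext.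
        replace B with A. reflexivity. unfold A, B. f_equal. lia.
      + unfold reflected_pred. rewrite Hc. unfold theta_coef. simpl. 
        assert (EBA : B = p * A). { unfold B. rewrite <- EA. f_equal. lia. }
        rewrite EBA. replace (factor_nome N) with (p * A).
        rewrite Nat.mul_0_r. simpl. field. lra. unfold factor_nome. rewrite <- EA. unfold p, nome_sq. rewrite <- pow_mult. f_equal. lia.
    - simpl reflected_pred. unfold theta_coef. 
      assert (Er : binom_ratio N (S j) = binom_ratio N j * ((1 - p * A) / (1 - B))).
      { rewrite binom_ratio_S. fold p. replace (N - j)%nat with (S N - S j)%nat by lia. rewrite EA.
        replace (N + j + 1 + d)%nat with (N + S j + d)%nat by lia. reflexivity. }
      rewrite Er.
      assert (PB' : 0 < 1 - B) by (apply one_minus_pow_pos; lia).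
      replace (q ^ (S j * S j + d * S j) * (binom_ratio N j * ((1 - p * A) / (1 - B))) * (p * A * ((1 - B) / (1 - p * A))))
        with ((q ^ (S j * S j + d * S j) * (p * A)) * binom_ratio N j) by (field; lra).
      replace (q ^ (S j * S j + d * S j) * (p * A)) with (factor_nome N * q ^ (j * j + d * j)). ring.
      rewrite <- EA. unfold factor_nome, p, nome_sq. rewrite <- pow_mult, <- !pow_add. f_equal. lia. }
  assert (Eself : binom_ratio (S N) j = (1 - p ^ S N) * (1 - p ^ (S N + d)) * binom_ratio N j / ((1 - p * A) * (1 - p * B))).
  { rewrite <- EA, <- EB. unfold p. rewrite <- binom_ratio_next by exact Hj. field.
    fold p. rewrite EA, EB. lra. }
  rewrite (Rmult_plus_distr_l (factor_nome N)), Eprev, Enext. unfold theta_coef. rewrite Eself.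
  unfold binom_growth. fold p. rewrite E1, E2, EQ.
  rewrite <- (three_term_identity p A B) by lra.
  assert (NZ : 1 + p * A * B + p * A * ((1 - B) / (1 - p * A)) + p * B * ((1 - A) / (1 - p * B)) <> 0).
  { intros H0. pose proof (three_term_identity p A B ltac:(lra) ltac:(lra)) as H. rewrite H0 in H.
    pose proof (Rmult_lt_0_compat _ _ PQ1 PQ2). lra. }
  set (W := 1 + p * A * B + p * A * ((1 - B) / (1 - p * A)) + p * B * ((1 - A) / (1 - p * B))) in *.
  replace ((1 + p * A * B) * (q ^ (j * j + d * j) * binom_ratio N j) + _) with (q ^ (j * j + d * j) * binom_ratio N j * W)
    by (unfold W; ring).
  field. repeat split; lra.
Qed.

(** The coefficient for N of index N + 1 vanishes, so in the induction step the
    only term crossing the upper end is the new leading coefficient. *)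
Lemma finite_triple_product (N : nat) (x : R) : (d <= 1)%nat ->
  theta_partial d (theta_coef N) N x = binom_ratio N N * (prefactor x * theta_product N x).
Proof.
  intros Hd. induction N as [|N IH].
  - unfold theta_partial, prefactor, theta_coef. simpl. rewrite Nat.mul_0_r. simpl. ring.
  - assert (HZ : theta_coef N (S N) = 0) by (unfold theta_coef; rewrite binom_ratio_vanish; ring).
    pose proof (theta_partial_mult d (theta_coef N) (1 + factor_nome N ^ 2) (factor_nome N) x N Hd) as H.
    rewrite HZ in H.
    assert (D1 : 0 < 1 - nome_sq ^ (2 * N + 1 + d)) by (apply one_minus_pow_pos; lia).
    assert (D2 : 0 < 1 - nome_sq ^ (2 * N + 2 + d)) by (apply one_minus_pow_pos; lia).
    assert (HR : binom_ratio (S N) (S N) = binom_growth N * binom_ratio N N).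
    { unfold binom_growth. pose proof (binom_ratio_diag N) as E.
      apply Rmult_eq_reg_r with ((1 - nome_sq ^ (2 * N + 1 + d)) * (1 - nome_sq ^ (2 * N + 2 + d))).
      - rewrite E. field. lra.
      - apply Rmult_integral_contrapositive. lra. }
    assert (HL : theta_coef (S N) (S N) = binom_growth N * (factor_nome N * theta_coef N N)).
    { unfold theta_coef. rewrite HR.
      replace (q ^ (S N * S N + d * S N)) with (factor_nome N * q ^ (N * N + d * N)). ring.
      unfold factor_nome. rewrite <- pow_add. f_equal. lia. }
    assert (HS : theta_partial d (theta_coef (S N)) (S N) x
       = binom_growth N * ((1 + factor_nome N ^ 2 + 2 * factor_nome N * cos x) * theta_partial d (theta_coef N) N x)).
    { rewrite H. unfold theta_partial. rewrite tech5, HL.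
      rewrite (theta_coef_recurrence N O Hd ltac:(lia)).
      rewrite (sum_eq (fun j => theta_coef (S N) j * shifted_cos d x j)
        (fun j => ((1 + factor_nome N ^ 2) * theta_coef N j + factor_nome N * (reflected_pred d (theta_coef N) j + theta_coef N (S j))) * shifted_cos d x j * binom_growth N)).
      2: { intros i Hi. rewrite (theta_coef_recurrence N i Hd Hi). ring. }
      rewrite <- scal_sum. ring. }
    rewrite HS, IH, HR. simpl theta_product. ring.
Qed.

(** An explicit rate, uniform in j, for the convergence of the ratios to 1; the
    factor p^j is absorbed by the Gaussian weights q^{j^2 + d j}. *)
Lemma binom_ratio_bounds (N j : nat) : 0 <= binom_ratio N j <= 1 /\ nome_sq ^ j * (1 - binom_ratio N j) <= INR j * nome_sq ^ N.
Proof.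
  pose proof nome_sq_bounds as Hp.
  induction j as [|j [IH1 IH2]]. simpl. lra.
  assert (R1 : 0 <= (1 - nome_sq ^ (N - j)) / (1 - nome_sq ^ (N + j + 1 + d)) <= 1
     /\ 1 - (1 - nome_sq ^ (N - j)) / (1 - nome_sq ^ (N + j + 1 + d)) <= nome_sq ^ (N - j)).
  { pose proof (one_minus_pow_pos (N + j + 1 + d) ltac:(lia)) as HD.
    assert (HA : 0 < nome_sq ^ (N - j)) by (apply pow_lt; lra).
    assert (HA1 : nome_sq ^ (N - j) <= 1).
    { destruct (N - j)%nat as [|n]. simpl; lra. left; apply nome_sq_pow_lt1. }
    assert (HB : nome_sq ^ (N + j + 1 + d) <= nome_sq ^ (N - j)).
    { replace (N + j + 1 + d)%nat with ((N - j) + ((N + j + 1 + d) - (N - j)))%nat by lia.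
      rewrite pow_add. assert (nome_sq ^ (N + j + 1 + d - (N - j)) <= 1).
      { destruct (N + j + 1 + d - (N - j))%nat as [|n]. simpl; lra. left; apply nome_sq_pow_lt1. }
      nra. }
    assert (HB0 : 0 < nome_sq ^ (N + j + 1 + d)) by (apply pow_lt; lra).
    set (u := nome_sq ^ (N - j)) in *. set (v := nome_sq ^ (N + j + 1 + d)) in *.
    assert (H1 : 1 - u <= (1 - u) / (1 - v)).
    { apply Rmult_le_reg_r with (1 - v). exact HD. unfold Rdiv. rewrite Rmult_assoc, Rinv_l; nra. }
    repeat split; try lra.
    apply Rmult_le_reg_r with (1 - v). exact HD. unfold Rdiv. rewrite Rmult_assoc, Rinv_l; nra. }
  rewrite binom_ratio_S. set (r := (1 - nome_sq ^ (N - j)) / (1 - nome_sq ^ (N + j + 1 + d))) in *.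
  destruct R1 as [[R0 R1] R2].
  split. nra.
  assert (HP : nome_sq ^ S j * nome_sq ^ (N - j) <= nome_sq ^ N).
  { rewrite <- pow_add. replace (S j + (N - j))%nat with (N + (S j + (N - j) - N))%nat by lia.
    rewrite pow_add. assert (nome_sq ^ (S j + (N - j) - N) <= 1).
    { destruct (S j + (N - j) - N)%nat as [|n]. simpl; lra. left; apply nome_sq_pow_lt1. }
    pose proof (pow_lt nome_sq N ltac:(lra)). nra. }
  pose proof (pow_lt nome_sq j ltac:(lra)) as Hj.
  rewrite S_INR. change (nome_sq ^ S j) with (nome_sq * nome_sq ^ j) in *.
  assert (nome_sq * nome_sq ^ j * (1 - binom_ratio N j) <= INR j * nome_sq ^ N).
  { assert (0 <= nome_sq ^ j * (1 - binom_ratio N j)) by nra. nra. }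
  assert (H2 : nome_sq * nome_sq ^ j * (binom_ratio N j * (1 - r)) <= nome_sq ^ N).
  { eapply Rle_trans; [|exact HP]. apply Rmult_le_compat_l. nra.
    apply Rle_trans with (1 * (1 - r)); [|lra]. apply Rmult_le_compat_r; lra. }
  replace (nome_sq * nome_sq ^ j * (1 - binom_ratio N j * r)) with
    (nome_sq * nome_sq ^ j * (1 - binom_ratio N j) + nome_sq * nome_sq ^ j * (binom_ratio N j * (1 - r))) by ring.
  lra.
Qed.
End FiniteProduct.

(** * Theta quotients as exponentials of weighted sums *)

Lemma pow_anti (q : R) (m n : nat) : 0 < q < 1 -> (n <= m)%nat -> q ^ m <= q ^ n.
Proof.
  intros Hq H. replace m with (n + (m - n))%nat by lia. rewrite pow_add.
  assert (q ^ (m - n) <= 1).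
  { rewrite <- (pow1 (m - n)). apply pow_incr. lra. }
  pose proof (pow_lt q n ltac:(lra)). nra.
Qed.

(** Half of theta_3 for d = 0, and theta_2 / (2 q^{1/4}) for d = 1. *)
Definition theta_half (d : nat) (q x : R) : R :=
  Series (fun j => q ^ (j * j + d * j) * shifted_cos d x j) - center_excess d * shifted_cos d x O.

Lemma ex_theta (d : nat) (q x : R) :
  0 < q < 1 -> ex_series (fun j => q ^ (j * j + d * j) * shifted_cos d x j).
Proof.
  intros Hq. apply (ex_series_dominated _ (fun j => q ^ j)).
  - intros j. rewrite Rabs_mult, (Rabs_pos_eq (q ^ _)) by (apply pow_le; lra).
    apply Rle_trans with (q ^ (j * j + d * j) * 1).
    + apply Rmult_le_compat_l. apply pow_le; lra. apply Rabs_le, COS_bound.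
    + rewrite Rmult_1_r. apply pow_anti. exact Hq. nia.
  - apply ex_series_geom. apply Rabs_def1; lra.
Qed.

Lemma sum_mult_pow_bounded (q : R) :
  0 < q < 1 -> exists K, forall N, sum_f_R0 (fun j => INR j * q ^ j) N <= K.
Proof.
  intros Hq.
  assert (Hl : ln q < 0) by (rewrite <- ln_1; apply ln_increasing; lra).
  assert (E : ex_series (fun j => INR j * q ^ j)).
  { apply ex_series_incr_1. generalize (ex_series_pow_exp 1 (- ln q) ltac:(lra)).
    apply ex_series_ext. intros k.
    replace (- (- ln q * INR (S k))) with (ln q * INR (S k)) by ring.
    rewrite <- exp_pow, exp_ln by lra. rewrite pow_1. reflexivity. }
  exists (Series (fun j => INR j * q ^ j)). intros N. rewrite <- sum_n_Reals.
  apply (is_lim_seq_incr_compare (sum_n (fun j => INR j * q ^ j))).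
  - apply Series_correct, E.
  - intros n. rewrite sum_Sn. unfold plus; simpl plus.
    assert (0 <= INR (S n) * q ^ S n) by (apply Rmult_le_pos; [apply pos_INR | apply pow_le; lra]).
    change (sum_n (fun j => INR j * q ^ j) n <= sum_n (fun j => INR j * q ^ j) n + INR (S n) * q ^ S n).
    lra.
Qed.

Lemma theta_partial_limit (d : nat) (q x : R) :
  0 < q < 1 ->
  is_lim_seq (fun N => theta_partial d (theta_coef q d N) N x) (theta_half d q x).
Proof.
  intros Hq. pose proof (nome_sq_bounds q Hq) as Hp.
  destruct (sum_mult_pow_bounded q Hq) as [K HK].
  set (e j := (j * j + d * j)%nat).
  set (A N := sum_f_R0 (fun j => q ^ e j * shifted_cos d x j) N - center_excess d * shifted_cos d x O).
  assert (HA : is_lim_seq A (theta_half d q x)).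
  { unfold A, theta_half.
    apply (is_lim_seq_minus' _ (fun _ => center_excess d * shifted_cos d x O)); [|apply is_lim_seq_const].
    apply (is_lim_seq_ext (sum_n (fun j => q ^ e j * shifted_cos d x j))).
    - intros n. apply sum_n_Reals.
    - apply Series_correct, ex_theta, Hq. }
  assert (Hb : forall N, Rabs (theta_partial d (theta_coef q d N) N x - A N) <= K / q ^ 2 * nome_sq q ^ N).
  { intros N. unfold theta_partial, A.
    replace (theta_coef q d N O) with 1 by (unfold theta_coef; rewrite !Nat.mul_0_r; simpl; ring).
    replace (_ - _ - _) with (sum_f_R0 (fun j => theta_coef q d N j * shifted_cos d x j - q ^ e j * shifted_cos d x j) N)
      by (rewrite (minus_sum (fun j => theta_coef q d N j * shifted_cos d x j) (fun j => q ^ e j * shifted_cos d x j)); ring).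
    eapply Rle_trans; [apply Rsum_abs|].
    apply Rle_trans with (sum_f_R0 (fun j => INR j * q ^ j * (nome_sq q ^ N / q ^ 2)) N).
    - apply sum_Rle. intros j _. unfold theta_coef. fold (e j).
      destruct (binom_ratio_bounds q Hq d N j) as [[R0 R1] R2].
      assert (Hq2 : 0 < q ^ 2) by (apply pow_lt; lra).
      replace (_ - _) with (- (q ^ e j * (1 - binom_ratio q d N j) * shifted_cos d x j)) by ring.
      rewrite Rabs_Ropp, Rabs_mult.
      assert (He : 0 < q ^ e j) by (apply pow_lt; lra).
      rewrite Rabs_pos_eq by (apply Rmult_le_pos; lra).
      apply Rle_trans with (q ^ e j * (1 - binom_ratio q d N j) * 1).
      { apply Rmult_le_compat_l. apply Rmult_le_pos; lra. apply Rabs_le, COS_bound. }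
      apply Rmult_le_reg_l with (1 := Hq2).
      replace (q ^ 2 * (INR j * q ^ j * (nome_sq q ^ N / q ^ 2))) with (q ^ j * (INR j * nome_sq q ^ N)) by (field; lra).
      apply Rle_trans with (q ^ j * (nome_sq q ^ j * (1 - binom_ratio q d N j))).
      2: { apply Rmult_le_compat_l. apply pow_le; lra. exact R2. }
      replace (q ^ 2 * (q ^ e j * (1 - binom_ratio q d N j) * 1)) with (q ^ 2 * q ^ e j * (1 - binom_ratio q d N j)) by ring.
      rewrite <- Rmult_assoc. apply Rmult_le_compat_r. lra.
      unfold nome_sq. rewrite <- pow_mult, <- !pow_add. apply pow_anti. exact Hq. unfold e.
      (* j^2 - 3 j + 2 = (j - 1) (j - 2), which explains the division by q^2. *)
      assert (3 * j <= j * j + 2)%nat by (destruct j as [|[|j]]; nia). nia.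
    - rewrite <- scal_sum. specialize (HK N).
      replace (K / q ^ 2 * nome_sq q ^ N) with (nome_sq q ^ N / q ^ 2 * K) by (field; lra).
      apply Rmult_le_compat_l; [|exact HK].
      apply Rmult_le_pos. apply pow_le; lra. left. apply Rinv_0_lt_compat, pow_lt; lra. }
  apply is_lim_seq_ext with (fun N => (theta_partial d (theta_coef q d N) N x - A N) + A N).
  { intros n. ring. }
  replace (Finite (theta_half d q x)) with (Finite (0 + theta_half d q x)) by (f_equal; ring).
  apply is_lim_seq_plus'; [|exact HA].
  apply is_lim_seq_abs_0.
  apply (is_lim_seq_le_le (fun _ => 0) _ (fun N => K / q ^ 2 * nome_sq q ^ N)).
  - intros n. split. apply Rabs_pos. apply Hb.
  - apply is_lim_seq_const.
  - replace (Finite 0) with (Rbar_mult (K / q ^ 2) 0) by (simpl; f_equal; ring).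
    apply is_lim_seq_scal_l, is_lim_seq_geom. apply Rabs_def1; lra.
Qed.

(** Twice the sum over n >= 1 of e^{-(2n-1+d) y}: csch for d = 0, coth - 1 for
    d = 1. *)
Definition log_kernel (d : nat) (y : R) : R := exp (- (INR d * y)) * csch y.

Lemma decays_log_kernel (d : nat) : decays 1 (log_kernel d).
Proof.
  intros y0 Hy0. destruct (decays_csch y0 Hy0) as [K HK]. exists K. intros y Hy.
  unfold log_kernel. rewrite Rabs_mult, (Rabs_pos_eq (exp _)) by (left; apply exp_pos).
  eapply Rle_trans; [|apply HK, Hy].
  rewrite <- (Rmult_1_l (Rabs (csch y))) at 2. apply Rmult_le_compat_r. apply Rabs_pos.
  rewrite <- exp_0. apply exp_le. pose proof (pos_INR d). nra.
Qed.

Lemma theta_product_pos (q x : R) (d N : nat) : 0 < q < 1 -> 0 < theta_product q d N x.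
Proof.
  intros Hq. induction N as [|N IH]; simpl theta_product. lra.
  apply Rmult_lt_0_compat. exact IH. apply quadratic_trig_pos.
  unfold factor_nome. split. pose proof (pow_lt q (2 * N + 1 + d) ltac:(lra)). lra.
  rewrite <- (pow1 (2 * N + 1 + d)). 
  apply Rle_lt_trans with (q ^ 1). apply pow_anti. exact Hq. lia. rewrite pow1. lra.
Qed.

(** Truncating the geometric series over n at N multiplies the kernel by
    1 - e^{-2 N y}. *)
Lemma log_theta_product_series (d N : nat) (s a b : R) :
  0 < s ->
  is_series (fun k => weight a b k *
      (log_kernel d (INR (S k) * s) * (1 - exp (- (2 * INR N * (INR (S k) * s))))))
    (ln (theta_product (exp (- s)) d N a) - ln (theta_product (exp (- s)) d N b)).
Proof.
  intros Hs.
  pose proof (exp_opp_bounds s Hs) as Hq.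
  induction N as [|N IH].
  - simpl theta_product. rewrite ln_1, Rminus_diag.
    apply (is_series_extR (fun _ => 0)); [|apply is_series_zero].
    intros k. change (INR 0) with 0. rewrite Rmult_0_r, Rmult_0_l, Ropp_0, exp_0. ring.
  - set (q := exp (- s)) in *.
    assert (HQ : 0 <= factor_nome q d N < 1).
    { unfold factor_nome. split. apply pow_le; lra.
      apply Rle_lt_trans with (q ^ 1). apply pow_anti. exact Hq. lia. lra. }
    pose proof (is_series_minus _ _ _ _ (log_cos_series a _ HQ) (log_cos_series b _ HQ)) as H.
    apply (is_series_scal_l 2) in H.
    pose proof (is_series_plus _ _ _ _ IH H) as H'. clear H.
    simpl theta_product.
    assert (PT : forall x, 0 < 1 + 2 * factor_nome q d N * cos x + factor_nome q d N ^ 2)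
      by (intros x; apply quadratic_trig_pos; lra).
    pose proof (PT a) as PTa. pose proof (PT b) as PTb. simpl in PTa, PTb.
    rewrite !ln_mult by (first [apply theta_product_pos, Hq | assumption]).
    replace (_ - _) with (plus (ln (theta_product q d N a) - ln (theta_product q d N b))
      (scal 2 (plus (ln (1 + 2 * factor_nome q d N * cos a + factor_nome q d N ^ 2) / 2)
              (opp (ln (1 + 2 * factor_nome q d N * cos b + factor_nome q d N ^ 2) / 2))))).
    2: { unfold plus, scal, opp; simpl. unfold mult; simpl. field. }
    revert H'. apply is_series_extR. intros k.
    set (n := INR (S k)).
    assert (Hn : 0 < n) by (unfold n; apply lt_0_INR; lia).
    assert (EQ : factor_nome q d N ^ S k = exp (- (INR d * (n * s))) * (exp (- (n * s)) * exp (- (2 * INR N * (n * s))))).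
    { unfold factor_nome, q. rewrite <- pow_mult, exp_pow, <- !exp_plus. apply f_equal.
      rewrite mult_INR, !plus_INR, mult_INR. fold n. simpl (INR 2). simpl (INR 1). ring. }
    change (weight a b k * (log_kernel d (n * s) * (1 - exp (- (2 * INR N * (n * s))))) +
      2 * ((-1) ^ k * cos (n * a) / n * factor_nome q d N ^ S k + - ((-1) ^ k * cos (n * b) / n * factor_nome q d N ^ S k)) =
      weight a b k * (log_kernel d (n * s) * (1 - exp (- (2 * INR (S N) * (n * s)))))).
    rewrite EQ. unfold weight. fold n. unfold log_kernel, csch, sinh.
    replace (- (2 * INR (S N) * (n * s))) with (- (2 * INR N * (n * s)) + (- (n * s) + - (n * s)))
      by (rewrite S_INR; ring).
    rewrite !exp_plus. set (E2 := exp (- (2 * INR N * (n * s)))). set (E0 := exp (- (INR d * (n * s)))).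
    assert (HE : 1 < exp (n * s)).
    { rewrite <- exp_0. apply exp_increasing. apply Rmult_lt_0_compat; assumption. }
    rewrite (exp_Ropp (n * s)). set (Z := exp (n * s)) in *.
    field. repeat split; try lra. apply Rgt_not_eq. nra.
Qed.

Lemma log_theta_product_limit (d : nat) (s a b : R) :
  0 < s ->
  is_lim_seq (fun N => ln (theta_product (exp (- s)) d N a) - ln (theta_product (exp (- s)) d N b))
    (wsum (weight a b) 0 (log_kernel d) s).
Proof.
  intros Hs.
  pose proof (weight_bounded a b) as Hw.
  pose proof (ex_wsum _ 2 1 0 _ s Hw Rlt_0_1 (decays_log_kernel d) Hs) as X.
  destruct (wsum_dominated _ 2 1 0 _ s Hw (decays_log_kernel d) Hs) as [K [HK0 HK]].
  set (u k := K * (INR (S k) ^ 0 * exp (- (1 * s * INR (S k))))).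
  assert (Hu : ex_series u) by (apply ex_series_scalR, ex_series_pow_exp; lra).
  assert (Hb : forall N, Rabs (ln (theta_product (exp (- s)) d N a) - ln (theta_product (exp (- s)) d N b)
     - wsum (weight a b) 0 (log_kernel d) s) <= Series u * exp (- (2 * s)) ^ N).
  { intros N. pose proof (log_theta_product_series d N s a b Hs) as HN.
    rewrite <- (is_series_unique _ _ HN). unfold wsum.
    rewrite <- Series_minus; [|eexists; exact HN | exact X].
    assert (Hd : forall k, Rabs (weight a b k * (log_kernel d (INR (S k) * s) * (1 - exp (- (2 * INR N * (INR (S k) * s)))))
         - weight a b k * (INR (S k) ^ 0 * log_kernel d (INR (S k) * s))) <= exp (- (2 * s)) ^ N * u k).
    { intros k.
      replace (_ - _) with (- (exp (- (2 * INR N * (INR (S k) * s))) * (weight a b k * (INR (S k) ^ 0 * log_kernel d (INR (S k) * s)))))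
        by (simpl; ring).
      rewrite Rabs_Ropp, Rabs_mult, (Rabs_pos_eq (exp _)) by (left; apply exp_pos).
      apply Rmult_le_compat. left; apply exp_pos. apply Rabs_pos.
      - rewrite exp_pow. apply exp_le. rewrite S_INR. pose proof (pos_INR k). pose proof (pos_INR N).
        assert (0 <= INR N * INR k * s) by (apply Rmult_le_pos; [apply Rmult_le_pos|]; lra). nra.
      - apply HK. lra. }
    eapply Rle_trans; [apply (Series_dominated _ _ Hd), ex_series_scalR, Hu|].
    rewrite Series_scal_l. lra. }
  set (v N := ln (theta_product (exp (- s)) d N a) - ln (theta_product (exp (- s)) d N b)) in *.
  set (l := wsum (weight a b) 0 (log_kernel d) s) in *.
  apply is_lim_seq_ext with (fun N => (v N - l) + l). { intros n. ring. }
  replace (Finite l) with (Finite (0 + l)) by (f_equal; ring).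
  apply is_lim_seq_plus'; [|apply is_lim_seq_const].
  apply is_lim_seq_abs_0.
  apply (is_lim_seq_le_le (fun _ => 0) _ (fun N => Series u * exp (- (2 * s)) ^ N)).
  - intros n. split. apply Rabs_pos. apply Hb.
  - apply is_lim_seq_const.
  - replace (Finite 0) with (Rbar_mult (Series u) 0) by (simpl; f_equal; ring).
    apply is_lim_seq_scal_l, is_lim_seq_geom.
    rewrite Rabs_pos_eq by (left; apply exp_pos). rewrite <- exp_0. apply exp_increasing. lra.
Qed.

(** Limit of the quotient of two instances of [finite_triple_product], whose
    common constant cancels.  The identity is kept free of divisions, as it is
    what shows that theta does not vanish. *)
Lemma theta_cross_identity (d : nat) (s a b : R) :
  (d <= 1)%nat -> 0 < s ->
  theta_half d (exp (- s)) a * prefactor d b =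
  theta_half d (exp (- s)) b * prefactor d a * exp (wsum (weight a b) 0 (log_kernel d) s).
Proof.
  intros Hd Hs.
  pose proof (exp_opp_bounds s Hs) as Hq.
  set (q := exp (- s)) in *.
  pose proof (theta_partial_limit d q a Hq) as La. pose proof (theta_partial_limit d q b Hq) as Lb.
  pose proof (log_theta_product_limit d s a b Hs) as LL. fold q in LL.
  assert (LE : is_lim_seq (fun N => exp (ln (theta_product q d N a) - ln (theta_product q d N b)))
     (exp (wsum (weight a b) 0 (log_kernel d) s))).
  { apply (is_lim_seq_continuous exp); [|exact LL].
    apply derivable_continuous_pt, derivable_pt_exp. }
  pose proof (is_lim_seq_scal_r _ (prefactor d b) _ La) as L1.
  pose proof (is_lim_seq_mult' _ _ _ _ (is_lim_seq_mult' _ _ _ _ Lb (is_lim_seq_const (prefactor d a))) LE) as L2.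
  assert (E : forall N, theta_partial d (theta_coef q d N) N a * prefactor d b =
     theta_partial d (theta_coef q d N) N b * prefactor d a * exp (ln (theta_product q d N a) - ln (theta_product q d N b))).
  { intros N. rewrite !(finite_triple_product q Hq d _ _ Hd).
    pose proof (theta_product_pos q a d N Hq). pose proof (theta_product_pos q b d N Hq).
    unfold Rminus. rewrite exp_plus, exp_Ropp, !exp_ln by assumption. field. lra. }
  apply (is_lim_seq_ext _ _ _ E) in L1.
  apply is_lim_seq_unique in L1. apply is_lim_seq_unique in L2. rewrite L1 in L2.
  simpl in L2. injection L2 as L2. exact L2.
Qed.

Lemma prefactor_pos (d : nat) (x : R) : (d <= 1)%nat -> 0 <= x < PI -> 0 < prefactor d x.
Proof.
  intros Hd Hx. unfold prefactor, center_excess, shifted_cos.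
  assert (Hc : d = O \/ d = 1%nat) by lia. destruct Hc as [-> | ->]; simpl.
  - replace ((0 + 0 / 2) * x) with 0 by field. rewrite cos_0. lra.
  - assert (0 < cos ((0 + 1 / 2) * x)) by (apply cos_gt_0; lra). lra.
Qed.

Lemma theta_half_0_pos (d : nat) (q : R) : 0 < q < 1 -> 0 < theta_half d q 0.
Proof.
  intros Hq. unfold theta_half.
  assert (C : forall j, shifted_cos d 0 j = 1).
  { intros j. unfold shifted_cos. rewrite Rmult_0_r. apply cos_0. }
  rewrite Series_incr_1 by (apply ex_theta, Hq). rewrite C, !Nat.mul_0_r.
  assert (0 <= Series (fun k => q ^ (S k * S k + d * S k) * shifted_cos d 0 (S k))).
  { replace 0 with (Series (fun _ : nat => 0)) at 1 by (apply is_series_unique, is_series_zero).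
    apply Series_le.
    - intros n. rewrite C. split. lra. rewrite Rmult_1_r. apply pow_le; lra.
    - apply (ex_series_incr_1 (fun j => q ^ (j * j + d * j) * shifted_cos d 0 j)), ex_theta, Hq. }
  assert (center_excess d <= / 2) by (unfold center_excess; destruct d; lra).
  change (q ^ (0 + 0)) with 1. cbv beta. lra.
Qed.

(** Were theta zero at b, [theta_cross_identity] between 0 and b would make it
    zero at 0, where all its terms are positive. *)
Lemma theta_quotient (d : nat) (s a b : R) :
  (d <= 1)%nat -> 0 < s -> 0 <= b < PI ->
  theta_half d (exp (- s)) a / theta_half d (exp (- s)) b =
  prefactor d a / prefactor d b * exp (wsum (weight a b) 0 (log_kernel d) s).
Proof.
  intros Hd Hs Hb.
  pose proof (prefactor_pos d b Hd Hb) as Pb.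
  pose proof (exp_opp_bounds s Hs) as Hq.
  assert (Nz : theta_half d (exp (- s)) b <> 0).
  { intros Z. pose proof (theta_cross_identity d s 0 b Hd Hs) as E. rewrite Z in E.
    pose proof (Rmult_lt_0_compat _ _ (theta_half_0_pos d _ Hq) Pb). lra. }
  pose proof (theta_cross_identity d s a b Hd Hs) as E.
  apply Rmult_eq_reg_r with (theta_half d (exp (- s)) b * prefactor d b).
  - transitivity (theta_half d (exp (- s)) a * prefactor d b). field. exact Nz.
    rewrite E. field. lra.
  - apply Rmult_integral_contrapositive. split. exact Nz. lra.
Qed.

Lemma nome_exp (t : R) : nome (PI * t) = exp (- (PI ^ 2 * t)).
Proof. unfold nome. apply f_equal. ring. Qed.

Lemma theta3_theta_half (x t : R) :
  0 < t -> theta3 (x / 2) (PI * t) = 2 * theta_half 0 (exp (- (PI ^ 2 * t))) (PI * x).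
Proof.
  intros Ht. unfold theta3, theta_half. rewrite nome_exp.
  assert (Hq : 0 < exp (- (PI ^ 2 * t)) < 1).
  { apply exp_opp_bounds, Rmult_lt_0_compat; [apply pow_lt, PI_RGT_0 | exact Ht]. }
  set (q := exp (- (PI ^ 2 * t))) in *.
  rewrite (Series_incr_1 (fun j => q ^ (j * j + 0 * j) * shifted_cos 0 (PI * x) j)) by (apply ex_theta, Hq).
  rewrite (Series_ext (fun n => q ^ (S n * S n) * cos (2 * INR (S n) * PI * (x / 2)))
    (fun k => q ^ (S k * S k + 0 * S k) * shifted_cos 0 (PI * x) (S k))).
  - replace (shifted_cos 0 (PI * x) 0) with 1.
    + change (q ^ (0 * 0 + 0 * 0)) with 1. unfold center_excess. field.
    + unfold shifted_cos. simpl INR. rewrite <- cos_0. apply f_equal. field.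
  - intros n. unfold shifted_cos. rewrite Nat.mul_0_l, Nat.add_0_r. f_equal. f_equal.
    simpl (INR 0). field.
Qed.

Lemma theta2_theta_half (x t : R) :
  0 < t -> theta2 (x / 2) (PI * t) =
    2 * Rpower (exp (- (PI ^ 2 * t))) (1 / 4) * theta_half 1 (exp (- (PI ^ 2 * t))) (PI * x).
Proof.
  intros Ht. unfold theta2, theta_half. rewrite nome_exp.
  set (q := exp (- (PI ^ 2 * t))).
  simpl center_excess. rewrite Rmult_0_l, Rminus_0_r, Rmult_assoc. f_equal.
  rewrite <- (Series_scal_l (Rpower q (1 / 4))).
  apply Series_ext. intros n. rewrite <- Rmult_assoc. f_equal.
  - rewrite <- (Rpower_pow (n * n + 1 * n)) by apply exp_pos. rewrite <- Rpower_plus. f_equal.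
    rewrite plus_INR, !mult_INR. simpl (INR 1). field.
  - unfold shifted_cos. f_equal. simpl (INR 1). field.
Qed.

(** * Monotonicity and convexity *)

Lemma strictly_increasing_derivative_convex (F F' : R -> R) :
  (forall t, 0 < t -> is_derive F t (F' t)) ->
  strictly_increasing_on positive_reals F' ->
  strictly_convex_on positive_reals F.
Proof.
  intros D Inc.
  assert (C : forall t, 0 < t -> continuity_pt F t).
  { intros t Ht. apply derivable_continuous_pt. eexists. apply is_derive_Reals, D, Ht. }
  assert (Main : forall x y a, 0 < x -> x < y -> 0 < a < 1 ->
     F (a * x + (1 - a) * y) < a * F x + (1 - a) * F y).
  { intros x y a Hx Hxy Ha. set (z := a * x + (1 - a) * y).
    assert (Hz : x < z < y) by (unfold z; nra).
    destruct (MVT_cor2 F F' x z ltac:(lra)) as [c1 [E1 H1]].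
    { intros c Hc. apply is_derive_Reals, D. lra. }
    destruct (MVT_cor2 F F' z y ltac:(lra)) as [c2 [E2 H2]].
    { intros c Hc. apply is_derive_Reals, D. lra. }
    assert (F' c1 < F' c2) by (apply Inc; unfold positive_reals; lra).
    assert (Ez : z - x = (1 - a) * (y - x)) by (unfold z; ring).
    assert (Ey : y - z = a * (y - x)) by (unfold z; ring).
    rewrite Ez in E1. rewrite Ey in E2.
    assert (E3 : a * F x + (1 - a) * F y - F z = a * (1 - a) * (y - x) * (F' c2 - F' c1)).
    { replace (F y) with (F z + F' c2 * (a * (y - x))) by lra.
      replace (F z) with (F x + F' c1 * ((1 - a) * (y - x))) by lra. ring. }
    assert (0 < a * (1 - a) * (y - x) * (F' c2 - F' c1)).
    { repeat apply Rmult_lt_0_compat; lra. }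
    lra. }
  intros x y a Hx Hy Hxy Ha. unfold positive_reals in *.
  destruct (Rtotal_order x y) as [H|[H|H]].
  - apply Main; assumption.
  - contradiction.
  - replace (a * x + (1 - a) * y) with ((1 - a) * y + (1 - (1 - a)) * x) by ring.
    replace (a * F x + (1 - a) * F y) with ((1 - a) * F y + (1 - (1 - a)) * F x) by ring.
    apply Main; lra.
Qed.

(** A nonnegative value would keep f above a positive constant from then on. *)
Lemma increasing_vanishing_neg (f : R -> R) (C e : R) :
  0 < e -> (forall s t, 0 < s -> s < t -> f s < f t) ->
  (forall s, 1 <= s -> Rabs (f s) <= C * exp (- (e * s))) ->
  forall s, 0 < s -> f s < 0.
Proof.
  intros He Inc HC s Hs. destruct (Rlt_le_dec (f s) 0) as [H|H]. exact H. exfalso.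
  pose proof (Inc s (s + 1) Hs ltac:(lra)) as H1.
  set (m := f (s + 1)) in *. assert (Hm : 0 < m) by lra.
  assert (HC0 : 0 < C).
  { specialize (HC (s + 1) ltac:(lra)). fold m in HC. rewrite Rabs_pos_eq in HC by lra.
    pose proof (exp_pos (- (e * (s + 1)))). nra. }
  (* A time by which the exponential bound has dropped below m, as e^x > x. *)
  set (t := s + 2 + C / (m * e)).
  assert (Hr : 0 < C / (m * e)) by (apply Rdiv_lt_0_compat; [|apply Rmult_lt_0_compat]; assumption).
  pose proof (Inc (s + 1) t ltac:(lra) ltac:(unfold t; lra)) as H2. fold m in H2.
  specialize (HC t ltac:(unfold t; lra)). rewrite Rabs_pos_eq in HC by lra.
  assert (H3 : C < m * exp (e * t)).
  { pose proof (exp_ineq1_le (e * t)).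
    assert (m * (e * (C / (m * e))) = C) by (field; lra).
    assert (e * (C / (m * e)) <= e * t) by (apply Rmult_le_compat_l; [lra | unfold t; lra]).
    nra. }
  assert (H4 : exp (- (e * t)) * exp (e * t) = 1) by (rewrite <- exp_plus, Rplus_opp_l; apply exp_0).
  pose proof (exp_pos (e * t)). pose proof (exp_pos (- (e * t))). nra.
Qed.

(** The derivative K c L1 e^L is negative, and it increases because both |L1| and
    e^L decrease. *)
Lemma log_convex_conclusion (F L L1 L2 : R -> R) (K c C e : R) :
  0 < K -> 0 < c -> 0 < e ->
  (forall t, 0 < t -> F t = K * exp (L (c * t))) ->
  (forall s, 0 < s -> is_derive L s (L1 s)) ->
  (forall s, 0 < s -> is_derive L1 s (L2 s)) ->
  (forall s, 0 < s -> 0 < L2 s) ->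
  (forall s, 1 <= s -> Rabs (L1 s) <= C * exp (- (e * s))) ->
  strictly_convex_on positive_reals F /\
  (forall t, 0 < t -> ex_derive F t /\ Derive F t < 0) /\
  strictly_increasing_on positive_reals (Derive F).
Proof.
  intros HK Hc He HF D1 D2 P V.
  assert (Inc : forall s t, 0 < s -> s < t -> L1 s < L1 t).
  { intros s t Hs Hst. apply (incr_function L1 0 (t + 1) L2); simpl; try lra.
    - intros x Hx _. apply D2, Hx.
    - intros x Hx _. apply P, Hx. }
  pose proof (increasing_vanishing_neg L1 C e He Inc V) as Neg.
  assert (Dec : forall s t, 0 < s -> s < t -> L t < L s).
  { intros s t Hs Hst. destruct (MVT_cor2 L L1 s t Hst) as [x [E Hx]].
    { intros x Hx. apply is_derive_Reals, D1. lra. }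
    pose proof (Neg x ltac:(lra)). nra. }
  set (F' t := K * c * (L1 (c * t) * exp (L (c * t)))).
  assert (DF : forall t, 0 < t -> is_derive F t (F' t)).
  { intros t Ht. assert (Hct : 0 < c * t) by (apply Rmult_lt_0_compat; assumption).
    apply (is_derive_ext_loc (fun t => K * exp (L (c * t)))).
    - apply locally_pos. exact Ht. intros r Hr. symmetry. apply HF, Hr.
    - auto_derive.
      + eexists. apply D1, Hct.
      + replace (Derive (fun x : R => L x) (c * t)) with (L1 (c * t))
          by (symmetry; apply is_derive_unique, D1, Hct).
        unfold F'. ring. }
  assert (EF : forall t, 0 < t -> Derive F t = F' t)
    by (intros t Ht; apply is_derive_unique, DF, Ht).
  assert (IncF : strictly_increasing_on positive_reals F').
  { intros x y Hx Hy Hxy. unfold positive_reals in *. unfold F'.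
    assert (Hcx : 0 < c * x) by (apply Rmult_lt_0_compat; assumption).
    assert (Hcxy : c * x < c * y) by (apply Rmult_lt_compat_l; assumption).
    apply Rmult_lt_compat_l. apply Rmult_lt_0_compat; assumption.
    pose proof (Inc _ _ Hcx Hcxy). pose proof (Neg (c * y) ltac:(lra)).
    pose proof (exp_increasing _ _ (Dec _ _ Hcx Hcxy)).
    pose proof (exp_pos (L (c * y))). nra. }
  split; [|split].
  - apply (strictly_increasing_derivative_convex F F' DF IncF).
  - intros t Ht. split. eexists; apply DF, Ht. rewrite EF by exact Ht.
    unfold F'. pose proof (Neg (c * t) (Rmult_lt_0_compat _ _ Hc Ht)).
    pose proof (exp_pos (L (c * t))). pose proof (Rmult_lt_0_compat _ _ HK Hc).
    assert (0 < - L1 (c * t) * exp (L (c * t))) by (apply Rmult_lt_0_compat; lra). nra.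
  - intros x y Hx Hy Hxy. unfold positive_reals in *. rewrite !EF by assumption.
    apply IncF; assumption.
Qed.

Lemma theta_quotient_convex (d : nat) (B a b : R) (F g1 g2 g3 g4 : R -> R) :
  (d <= 1)%nat -> 0 <= B -> 0 <= a -> a < b -> b < PI ->
  (forall t, 0 < t -> F t = theta_half d (exp (- (PI ^ 2 * t))) a / theta_half d (exp (- (PI ^ 2 * t))) b) ->
  (forall y, 0 < y -> is_derive (log_kernel d) y (g1 y)) ->
  (forall y, 0 < y -> is_derive g1 y (g2 y)) ->
  (forall y, 0 < y -> is_derive g2 y (g3 y)) ->
  (forall y, 0 < y -> is_derive g3 y (g4 y)) ->
  decays 1 g1 -> decays 1 g2 -> decays 1 g3 ->
  (forall y, 0 < y -> 0 < corrected_second B g2 g3 g4 y) ->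
  strictly_convex_on positive_reals F /\
  (forall t, 0 < t -> ex_derive F t /\ Derive F t < 0) /\
  strictly_increasing_on positive_reals (Derive F).
Proof.
  intros Hd HB Ha Hab Hb HF D0 D1 D2 D3 E1 E2 E3 P.
  pose proof (weight_bounded a b) as Hw.
  destruct (wsum_vanishes (weight a b) 2 1 1 g1 Hw Rlt_0_1 E1) as [C HC].
  apply (log_convex_conclusion F (wsum (weight a b) 0 (log_kernel d)) (wsum (weight a b) 1 g1)
    (wsum (weight a b) 2 g2) (prefactor d a / prefactor d b) (PI ^ 2) C (1 / 2)).
  - apply Rdiv_lt_0_compat; apply prefactor_pos; try assumption; lra.
  - apply pow_lt, PI_RGT_0.
  - lra.
  - intros t Ht. rewrite HF by exact Ht. apply theta_quotient; try assumption; try lra.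
    apply Rmult_lt_0_compat. apply pow_lt, PI_RGT_0. exact Ht.
  - intros s Hs. apply (is_derive_wsum _ 2 1 0 (log_kernel d) g1 g2); auto. lra. apply decays_log_kernel.
  - intros s Hs. apply (is_derive_wsum _ 2 1 1 g1 g2 g3); auto. lra.
  - intros s Hs. apply (wsum_second_pos a b B s g2 g3 g4); assumption.
  - exact HC.
Qed.

Theorem theorem1p2 (u v : R) (hu : 0 <= u) (huv : u < v) (hv : v < 1) :
  (strictly_convex_on positive_reals (fun t => S2 u v t) /\
   (forall t : R, 0 < t ->
      ex_derive (fun s => S2 u v s) t /\ Derive (fun s => S2 u v s) t < 0) /\
   strictly_increasing_on positive_reals (Derive (fun s => S2 u v s))) /\
  (strictly_convex_on positive_reals (fun t => S3 u v t) /\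
   (forall t : R, 0 < t ->
      ex_derive (fun s => S3 u v s) t /\ Derive (fun s => S3 u v s) t < 0) /\
   strictly_increasing_on positive_reals (Derive (fun s => S3 u v s))).
Proof.
  pose proof PI_RGT_0 as Hpi.
  assert (Ha : 0 <= PI * u) by (apply Rmult_le_pos; lra).
  assert (Hab : PI * u < PI * v) by (apply Rmult_lt_compat_l; lra).
  assert (Hb : PI * v < PI) by nra.
  split.
  - apply (theta_quotient_convex 1 0 (PI * u) (PI * v) _ coth1 coth2 coth3 coth4);
      try assumption; try lra; try lia.
    + intros t Ht. unfold S2. rewrite !theta2_theta_half by exact Ht.
      set (r := Rpower _ _). assert (0 < r) by apply exp_pos.
      unfold Rdiv. rewrite Rinv_mult. 
      set (i := / theta_half 1 _ _). field. lra.
    + intros y Hy. apply (is_derive_ext coth0).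
      { intros t. unfold coth0, log_kernel. simpl INR. rewrite Rmult_1_l. reflexivity. }
      apply is_derive_coth0, Hy.
    + apply is_derive_coth1.
    + apply is_derive_coth2.
    + apply is_derive_coth3.
    + apply decays_coth1.
    + apply decays_coth2.
    + apply decays_coth3.
    + apply coth_corrected_second_pos.
  - apply (theta_quotient_convex 0 (3 / 2) (PI * u) (PI * v) _ csch1 csch2 csch3 csch4);
      try assumption; try lra; try lia.
    + intros t Ht. unfold S3. rewrite !theta3_theta_half by exact Ht.
      unfold Rdiv. rewrite Rinv_mult. 
      set (i := / theta_half 0 _ _). field.
    + intros y Hy. apply (is_derive_ext csch).
      { intros t. unfold log_kernel. simpl INR. rewrite Rmult_0_l, Ropp_0, exp_0. symmetry. apply Rmult_1_l. }
      apply is_derive_csch, Hy.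
    + apply is_derive_csch1.
    + apply is_derive_csch2.
    + apply is_derive_csch3.
    + apply decays_csch1.
    + apply decays_csch2.
    + apply decays_csch3.
    + apply csch_corrected_second_pos.
Qed.
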